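(* The Dennis family of quasi-Newton updates is the posterior mean after one step ($M=1$) of Gaussian regression on matrix elements. That is: let $B_0\in\mathbb{R}^{N\times N}$ be symmetric, let $s\in\mathbb{R}^N$ with $s\neq0$, and let $y\in\mathbb{R}^N$ be of the form $y=\tilde Bs$ for some symmetric $\tilde B\in\mathbb{R}^{N\times N}$. For a symmetric positive definite $W\in\mathbb{R}^{N\times N}$, let $B_1(W)$ be the posterior mean of a random symmetric matrix $B$ with prior $\mathrm{vec}(B)\sim\mathcal{N}(\mathrm{vec}(B_0),W\circledast W)$ given the single noise-free observation $Bs=y$. Then the set of matrices $B_1(W)$, with $W$ ranging over the symmetric positive definite matrices, equals the set of Dennis updates $$ B_{0} + \frac{(y-B_{0}s)c^{\top} + c(y-B_{0}s)^{\top}}{c^{\top} s} - \frac{c\, s^{\top}(y-B_0s)\, c^{\top}}{(c^{\top} s)^2}, $$ with $c$ ranging over the vectors in $\mathbb{R}^N$ with $c^{\top}s\neq0$.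
   Context: For $A\in\mathbb{R}^{N\times N}$, $\mathrm{vec}(A)\in\mathbb{R}^{N^2}$ is the vector of its elements, indexed by pairs: $\mathrm{vec}(A)_{(ij)}=A_{ij}$. For symmetric $A$, $A\circledast A$ is the $N^2\times N^2$ matrix with elements $(A\circledast A)_{(ij),(k\ell)}=\tfrac12(A_{ik}A_{j\ell}+A_{jk}A_{i\ell})$ (symmetric Kronecker product). $\mathcal{N}(\mu,\Sigma)$ denotes the (possibly degenerate) Gaussian law with mean $\mu$ and covariance $\Sigma$. The posterior given a noise-free observation $Bs=y$ is the conditional distribution of $\mathrm{vec}(B)$ given $Bs=y$ (equivalently, the limit $\sigma\to 0$ of the posteriors under Gaussian likelihood with mean $Bs$ and covariance $\sigma^2 I$), and the posterior mean is its mean. The Dennis family of quasi-Newton methods is the family of updates displayed in the claim, one for each choice of the vector $c$. *)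

(* Defs.v *)
From HB Require Import structures.
From mathcomp Require Import all_boot all_order all_algebra.
From mathcomp Require Import all_classical all_reals all_analysis.

Set Implicit Arguments.
Unset Strict Implicit.
Unset Printing Implicit Defensive.

Import Order.TTheory GRing.Theory Num.Theory.
Import numFieldTopology.Exports.

Local Open Scope classical_set_scope.
Local Open Scope ring_scope.

(* Real matrices (hence row and column vectors) carry the Borel
   sigma-algebra of their usual topology. *)
Fact matrix_display : measure_display. Proof. exact: default_measure_display. Qed.

Section borel_matrix.
Variables (R : realType) (m n : nat).

Definition matrix_borel : set (set 'M[R]_(m, n)) := <<s open >>.

Let matrix_borel0 : matrix_borel set0.
Proof. exact: sigma_algebra0. Qed.

Let matrix_borelC A : matrix_borel A -> matrix_borel (~` A).
Proof. by move=> mA; rewrite -setTD; exact: sigma_algebraCD. Qed.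

Let matrix_borel_bigcup (F : (set 'M[R]_(m, n))^nat) :
  (forall i, matrix_borel (F i)) -> matrix_borel (\bigcup_i F i).
Proof. exact: sigma_algebra_bigcup. Qed.

HB.instance Definition _ := @isMeasurable.Build matrix_display 'M[R]_(m, n)
  matrix_borel matrix_borel0 matrix_borelC matrix_borel_bigcup.

End borel_matrix.

Definition dot (R : realType) (n : nat) (u v : 'cV[R]_n) : R := (u^T *m v) 0 0.

Definition posdef (R : realType) (N : nat) (W : 'M[R]_N) : Prop :=
  W^T = W /\ forall x : 'cV[R]_N, x != 0 -> 0 < dot x (W *m x).

(* vec(A) is [mxvec A], with the pair (i, j) encoded as [mxvec_index i j];
   [mxvec_pair] is the inverse encoding. *)
Definition mxvec_pair (m n : nat) (p : 'I_(m * n)) : 'I_m * 'I_n :=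
  enum_val (cast_ord (esym (mxvec_cast m n)) p).

Definition symkron (R : realType) (N : nat) (A : 'M[R]_N) : 'M[R]_(N * N) :=
  \matrix_(p, q)
    let: (i, j) := mxvec_pair p in
    let: (k, l) := mxvec_pair q in
    2^-1 * (A i k * A j l + A j k * A i l).

Lemma mxvec_indexK (m n : nat) (i : 'I_m) (j : 'I_n) :
  mxvec_pair (mxvec_index i j) = (i, j).
Proof. by rewrite /mxvec_pair /mxvec_index cast_ordK enum_rankK. Qed.

Lemma symkronE (R : realType) (N : nat) (A : 'M[R]_N) (i j k l : 'I_N) :
  symkron A (mxvec_index i j) (mxvec_index k l) =
  2^-1 * (A i k * A j l + A j k * A i l).
Proof. by rewrite mxE !mxvec_indexK. Qed.

(* The law N(m, v) on the line, parametrised by its variance v >= 0.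
   [normal_prob m 0] is not a Dirac mass in the library. *)
Definition normal_law (R : realType) (m v : R) : set R -> \bar R :=
  if v == 0 then \d_m else normal_prob m (Num.sqrt v).

(* Possibly degenerate Gaussian law: every linear functional of X is a
   (possibly degenerate) real Gaussian with the corresponding parameters. *)
Definition gaussian_vector (R : realType) (n : nat) d (T : measurableType d)
    (P : probability T R) (X : T -> 'rV[R]_n) (m : 'rV[R]_n) (S : 'M[R]_n) :
    Prop :=
  forall (t : 'cV[R]_n) (A : set R), measurable A ->
    P ((fun w => (X w *m t) 0 0) @^-1` A) =
    normal_law ((m *m t) 0 0) (dot t (S *m t)) A.

(* [k] is a regular conditional distribution of X given Y. *)
Definition cond_distribution (R : realType) d (T : measurableType d)
    (P : probability T R) dX (TX : measurableType dX) dY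
    (TY : measurableType dY) (X : T -> TX) (Y : T -> TY)
    (k : R.-pker TY ~> TX) : Prop :=
  forall (A : set TX) (C : set TY), measurable A -> measurable C ->
    P (X @^-1` A `&` Y @^-1` C) = (\int[P]_(w in Y @^-1` C) k (Y w) A)%E.

Definition weakly_continuous (R : realType) (m n p q : nat)
    (k : R.-pker 'M[R]_(p, q) ~> 'M[R]_(m, n)) : Prop :=
  forall f : 'M[R]_(m, n) -> R, continuous f ->
    (exists K : R, forall x, `|f x| <= K) ->
    continuous (fun u => \int[k u]_x f x : R).

(* Conditioning on the single value [B s = y], an event of probability 0,
   uses the weakly continuous version of the conditional distribution of B
   given [B s]; it is unique when, as for W positive definite and s <> 0,
   the law of [B s] has full support. *)
Definition is_posterior (R : realType) (N : nat) d (T : measurableType d)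
    (P : probability T R) (B : T -> 'M[R]_N) (s y : 'cV[R]_N)
    (nu : set 'M[R]_N -> \bar R) : Prop :=
  exists k : R.-pker 'cV[R]_N ~> 'M[R]_N,
    [/\ cond_distribution P B (fun w => B w *m s) k,
        weakly_continuous k
      & nu = k y].

Definition is_mean (R : realType) (m n : nat)
    (nu : probability 'M[R]_(m, n) R) (M : 'M[R]_(m, n)) : Prop :=
  forall i j, nu.-integrable setT (fun X => (X i j)%:E) /\
    M i j = \int[nu]_X (X i j).

Definition is_posterior_mean (R : realType) (N : nat) (B0 W : 'M[R]_N)
    (s y : 'cV[R]_N) (M : 'M[R]_N) : Prop :=
  exists d (T : measurableType d) (P : probability T R)
         (B : {mfun T >-> 'M[R]_N}) (nu : probability 'M[R]_N R),
    [/\ forall w, (B w)^T = B w,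
        gaussian_vector P (fun w => mxvec (B w)) (mxvec B0) (symkron W),
        is_posterior P B s y nu
      & is_mean nu M].

Definition dennis_update (R : realType) (N : nat) (B0 : 'M[R]_N)
    (s y c : 'cV[R]_N) : 'M[R]_N :=
  let r := y - B0 *m s in
  B0 + (dot c s)^-1 *: (r *m c^T + c *m r^T)
     - (dot c s ^+ 2)^-1 *: (c *m s^T *m r *m c^T).

(* Main.v *)
(** Put c = W s.  For symmetric X the update is the affine function
    F(u) = dennis_update B0 s u c, and F((B0 + X) s) = B0 + (X - P X P^T) for
    the projection P = 1 - c s^T / (c^T s), which satisfies P W = W P^T and
    P^T s = 0.  Because of the first relation, if X and X' are independent
    copies of the centred Gaussian matrix with covariance the symmetric
    Kronecker square of W, then B = B0 + (X - P X P^T) + P X' P^T again has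
    the prior law; because of the second one, B s is independent of X' and
    B = F(B s) + P X' P^T.  Hence the law of F(u) + P X' P^T is a weakly
    continuous version of the conditional law of B given B s = u, and its mean
    is F(u).  The vectors c = W s with W positive definite are, up to a sign
    that the update ignores, the vectors c with c^T s != 0.

    The definition of the posterior quantifies over all probability spaces, so
    that a uniqueness argument is needed which uses the prior only through the
    laws of the linear functionals of B.  The moments of cos (tr (B^T A) + th)
    are determined by these laws.  Since 1 + 1 / (1 + x^2) is a mixture of the
    functions 1 + cos (xi x), multiplying by such bumps in the coordinates of
    B s - y and linearising products of cosines leaves the moments determined.
    High powers of the product of the bumps concentrate at B s = y, so weak
    continuity gives the cosine moments of the posterior, and their derivatives
    at 0 give its mean. *)
From HB Require Import structures.
Require Import Defs.
From mathcomp Require Import all_boot all_order all_algebra ring lra.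
From mathcomp Require Import all_classical all_reals all_analysis.
From mathcomp Require Import measurable_realfun.

Set Implicit Arguments.
Unset Strict Implicit.
Unset Printing Implicit Defensive.

Import Order.TTheory GRing.Theory Num.Theory.
Import numFieldNormedType.Exports.

Local Open Scope classical_set_scope.
Local Open Scope ring_scope.

(** * Linear algebra of the updates *)

Section linear_algebra.
Variable R : realType.

Lemma dotE n (u v : 'cV[R]_n) : dot u v = \sum_i u i 0 * v i 0.
Proof. by rewrite /dot mxE; apply: eq_bigr => i _; rewrite mxE. Qed.

Lemma dotC n (u v : 'cV[R]_n) : dot u v = dot v u.
Proof. by rewrite !dotE; apply: eq_bigr => i _; rewrite mulrC. Qed.

Lemma dotDr n (u v w : 'cV[R]_n) : dot u (v + w) = dot u v + dot u w.
Proof. by rewrite /dot mulmxDr mxE. Qed.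

Lemma dotZr n (a : R) (u v : 'cV[R]_n) : dot u (a *: v) = a * dot u v.
Proof. by rewrite /dot -scalemxAr mxE. Qed.

Lemma dotDl n (u v w : 'cV[R]_n) : dot (u + v) w = dot u w + dot v w.
Proof. by rewrite !(dotC _ w) dotDr. Qed.

Lemma dotZl n (a : R) (u v : 'cV[R]_n) : dot (a *: u) v = a * dot u v.
Proof. by rewrite !(dotC _ v) dotZr. Qed.

Lemma dot_ge0 n (u : 'cV[R]_n) : 0 <= dot u u.
Proof. by rewrite dotE sumr_ge0// => i _; rewrite -expr2 sqr_ge0. Qed.

Lemma dot_eq0 n (u : 'cV[R]_n) : (dot u u == 0) = (u == 0).
Proof.
apply/eqP/eqP => [|->]; last by rewrite /dot mulmx0 mxE.
rewrite dotE => /eqP; rewrite psumr_eq0 => [|i _]; last by rewrite -expr2 sqr_ge0.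
move=> /allP u0; apply/colP => i; rewrite mxE; apply/eqP.
by have := u0 i (mem_index_enum _); rewrite mulf_eq0 orbb.
Qed.

Lemma mulmx_tr_dot n m (c : 'cV[R]_m) (u v : 'cV[R]_n) :
  c *m u^T *m v = dot u v *: c.
Proof.
rewrite -mulmxA; apply/colP => i; rewrite !mxE big_ord1 mulrC.
by congr (_ * _); rewrite !mxE; apply: eq_bigr => j _; rewrite !mxE.
Qed.

Lemma tr_outer n m (u : 'cV[R]_n) (v : 'cV[R]_m) : (u *m v^T)^T = v *m u^T.
Proof. by rewrite trmx_mul trmxK. Qed.

Lemma trmxD n m (A B : 'M[R]_(n, m)) : (A + B)^T = A^T + B^T.
Proof. by apply/matrixP => i j; rewrite !mxE. Qed.

Lemma trmxN n m (A : 'M[R]_(n, m)) : (- A)^T = - A^T.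
Proof. by apply/matrixP => i j; rewrite !mxE. Qed.

Lemma trmxZ n m (a : R) (A : 'M[R]_(n, m)) : (a *: A)^T = a *: A^T.
Proof. by apply/matrixP => i j; rewrite !mxE. Qed.

Lemma dennis_update_sym N (B0 : 'M[R]_N) s y c : B0^T = B0 ->
  (dennis_update B0 s y c)^T = dennis_update B0 s y c.
Proof.
move=> B0T; rewrite /dennis_update; set r := y - _.
rewrite mulmx_tr_dot -scalemxAl; move: r => r.
by rewrite !(trmxD, trmxN, trmxZ) !tr_outer B0T (addrC (c *m _)).
Qed.

(** Applied to [s], the rank-two term yields [r] plus a multiple of [c], and the last term cancels
    exactly that multiple. *)
Lemma dennis_update_secant N (B0 : 'M[R]_N) s y c : dot c s != 0 ->
  dennis_update B0 s y c *m s = y.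
Proof.
move=> cs0; rewrite /dennis_update; set r := y - _.
rewrite mulmx_tr_dot mulmxBl mulmxDl -!scalemxAl mulmxDl !mulmx_tr_dot.
rewrite scalerDr !scalerA mulVf// scale1r.
rewrite (_ : _ ^- 2 * _ * _ = (dot c s)^-1 * dot r s).
  by rewrite addrA addrK /r subrKC.
by rewrite (dotC r); field.
Qed.

Lemma dennis_updateN N (B0 : 'M[R]_N) s y c :
  dennis_update B0 s y (- c) = dennis_update B0 s y c.
Proof.
have dN : dot (- c) s = - dot c s by rewrite -scaleN1r dotZl mulN1r.
rewrite /dennis_update dN sqrrN; set r := y - _.
have -> : r *m (- c)^T + - c *m r^T = - (r *m c^T + c *m r^T).
  by rewrite trmxN mulmxN mulNmx opprD.
by rewrite trmxN mulmxN !mulNmx opprK invrN scaleNr scalerN opprK.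
Qed.

Lemma posdef_curvature N (W : 'M[R]_N) (s : 'cV[R]_N) :
  posdef W -> s != 0 -> 0 < dot (W *m s) s.
Proof. by move=> [_ W0] s0; rewrite dotC W0. Qed.

(** This is the converse of [posdef_curvature]: positive curvature along [s] is the only obstruction
    to solving [W *m s = c] with [W] positive definite. *)
Lemma posdef_secant N (s c : 'cV[R]_N) : 0 < dot c s ->
  exists2 W : 'M[R]_N, posdef W & W *m s = c.
Proof.
move=> cs0.
have s0 : s != 0 by apply: contraTneq cs0 => ->; rewrite /dot mulmx0 mxE ltxx.
have ss0 : dot s s != 0 by rewrite dot_eq0.
(* The rank-one term maps [s] to [c]; the other term is the orthogonal projection that kills [s].
   The two quadratic forms can vanish together only at 0, because a vector parallel to [s] is seen
   by the first one. *)
pose W := (dot c s)^-1 *: (c *m c^T) + (1%:M - (dot s s)^-1 *: (s *m s^T)).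
have Wx x : W *m x = (dot c x / dot c s) *: c + (x - (dot s x / dot s s) *: s).
  rewrite /W mulmxDl mulmxBl mul1mx -!scalemxAl !mulmx_tr_dot !scalerA.
  by rewrite !(mulrC (_^-1)).
exists W; last by rewrite Wx !divff ?(gt_eqF cs0)// !scale1r subrr addr0.
split; first by rewrite /W !(trmxD, trmxN, trmxZ) !tr_outer tr_scalar_mx.
move=> x x0; rewrite Wx.
set r := x - _; have rs : dot s r = 0.
  by rewrite /r -scaleN1r dotDr !dotZr mulN1r divfK// subrr.
have xr : x = r + (dot s x / dot s s) *: s by rewrite /r subrK.
rewrite dotDr dotZr.
have -> : dot x r = dot r r by rewrite {1}xr dotDl dotZl rs mulr0 addr0.
rewrite (dotC x) mulrAC -expr2.
have [r0|r0] := eqVneq r 0; last first.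
  by rewrite ltr_wpDl ?lt0r ?dot_ge0 ?dot_eq0 ?r0// divr_ge0 ?sqr_ge0// ltW.
have -> : dot r r = 0 by apply/eqP; rewrite dot_eq0 r0.
rewrite addr0 divr_gt0// exprn_even_gt0//=.
have sx0 : dot s x != 0.
  by apply: contraNneq x0 => sx; rewrite xr r0 sx mul0r scale0r addr0.
by rewrite xr r0 add0r dotZr mulf_neq0 ?mulf_neq0 ?invr_neq0// (gt_eqF cs0).
Qed.

(** The curvature of [W *m s] is positive; when that of [c] is negative, [- c] is used instead,
    which gives the same update. *)
Lemma dennis_posdef N (B0 : 'M[R]_N) (s y : 'cV[R]_N) : s != 0 ->
  [set dennis_update B0 s y (W *m s) | W in [set W : 'M[R]_N | posdef W]] =
  [set dennis_update B0 s y c | c in [set c : 'cV[R]_N | dot c s != 0]].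
Proof.
move=> s0; apply/seteqP; split => [_ [W Wpos <-]|_ [c /= cs0 <-]].
  by exists (W *m s) => //=; rewrite gt_eqF// posdef_curvature.
have [cs|cs] := ltP 0 (dot c s).
  by have [W Wpos Ws] := posdef_secant cs; exists W => //; rewrite Ws.
have [|W Wpos Ws] := @posdef_secant N s (- c).
  by rewrite -scaleN1r dotZl mulN1r oppr_gt0 lt_neqAle cs0.
by exists W => //; rewrite Ws dennis_updateN.
Qed.

(** Induction on the size: split off the first row and column and factor the Schur complement of the
    pivot, which is again positive definite. *)
Lemma posdef_cholesky N (W : 'M[R]_N) : posdef W ->
  exists L : 'M[R]_N, W = L *m L^T.
Proof.
elim: N W => [|N IH] W; first by exists 0; apply/matrixP => -[].
rewrite -[N.+1]/(1 + N)%N in W *.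
rewrite -(submxK W); set a := ulsubmx W; set b := ursubmx W.
set b' := dlsubmx W; set D := drsubmx W => -[WT W0].
have [_ bE DT] : [/\ a^T = a, b'^T = b & D^T = D].
  by move: WT; rewrite tr_block_mx => /eq_block_mx[].
have b'E : b' = b^T by rewrite -bE trmxK.
have aE : a = (a 0 0)%:M by rewrite [LHS]mx11_scalar.
set al := a 0 0 in aE.
have quad (x : 'cV[R]_1) (v : 'cV[R]_N) :
    dot (col_mx x v) (block_mx a b b' D *m col_mx x v) =
    al * x 0 0 ^+ 2 + 2 * x 0 0 * dot b^T v + dot v (D *m v).
  rewrite mul_block_col {1}/dot tr_col_mx mul_row_col mxE b'E aE.
  rewrite mul_scalar_mx mulmxDr !mulmxDr.
  have -> : x^T = (x 0 0)%:M by rewrite [LHS]mx11_scalar mxE.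
  have -> : x = (x 0 0)%:M by rewrite [LHS]mx11_scalar.
  set z := x 0 0; rewrite !mxE !big_ord1 !mxE eqxx /= !mulr1n.
  have -> : \sum_j b ord0 j * v j 0 = dot b^T v.
    by rewrite dotE; apply: eq_bigr => j _; rewrite [in RHS]mxE.
  have -> : \sum_j v^T 0 j * (b^T *m z%:M) j 0 = z * dot b^T v.
    rewrite mul_mx_scalar dotC -dotZr dotE; apply: eq_bigr => j _.
    by rewrite !mxE.
  have -> : \sum_j v^T 0 j * (D *m v) j 0 = dot v (D *m v) by rewrite /dot mxE.
  ring.
have al0 : 0 < al.
  have := W0 (col_mx 1%:M 0); rewrite quad mxE eqxx /= expr1n mulr1.
  rewrite {1 2}/dot !mulmx0 !mxE mulr0 !addr0; apply.
  apply: contraTneq (oner_neq0 R) => /eqP.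
  by rewrite col_mx_eq0 => /andP[/eqP/matrixP/(_ 0 0)]; rewrite !mxE eqxx => /eqP ->.
have [|L LE] := IH (D - al^-1 *: (b^T *m b)).
  split; first by rewrite !(trmxD, trmxN, trmxZ) trmx_mul trmxK DT.
  (* For fixed [v], this first coordinate minimises the quadratic form, and the minimum is the form
     of the Schur complement at [v]. *)
  move=> v v0; have := W0 (col_mx (- al^-1 * dot b^T v)%:M v).
  rewrite quad !mxE eqxx /= mulr1n => /(_ _)/lt_le_trans; apply.
    by apply: contraNneq v0 => /eqP; rewrite col_mx_eq0 => /andP[].
  rewrite mulmxBl dotDr -[- (_ *m _)]scaleN1r dotZr -scalemxAl dotZr.
  have -> : dot v (b^T *m b *m v) = dot b^T v ^+ 2.
    rewrite -{2}(trmxK b) mulmx_tr_dot dotZr (dotC v) expr2 //.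
  rewrite le_eqVlt; apply/orP; left; apply/eqP.
  by have al0' := lt0r_neq0 al0; field.
exists (block_mx (Num.sqrt al)%:M 0 ((Num.sqrt al)^-1 *: b^T) L).
have sq0 : Num.sqrt al != 0 by rewrite gt_eqF// sqrtr_gt0.
have sqE : Num.sqrt al * Num.sqrt al = al by rewrite -expr2 sqr_sqrtr// ltW.
rewrite tr_block_mx mulmx_block !trmx0 !mulmx0 !mul0mx !addr0.
rewrite tr_scalar_mx trmxZ trmxK -LE -scalar_mxM sqE -aE.
rewrite mul_scalar_mx scalerA divff// scale1r mul_mx_scalar scalerA divff//.
rewrite scale1r b'E -scalemxAl -scalemxAr scalerA -invfM sqE.
by rewrite addrC subrK.
Qed.

(** * Symmetrisation and the symmetric Kronecker form *)

Definition symm N (T : 'M[R]_N) : 'M[R]_N := 2^-1 *: (T + T^T).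

Lemma symmE N (T : 'M[R]_N) i j : symm T i j = 2^-1 * (T i j + T j i).
Proof. by rewrite /symm !mxE. Qed.

Lemma symm_tr N (T : 'M[R]_N) : (symm T)^T = symm T.
Proof. by rewrite /symm trmxZ trmxD trmxK addrC. Qed.

Lemma symm_id N (T : 'M[R]_N) : T^T = T -> symm T = T.
Proof.
move=> TT; rewrite /symm TT -mulr2n -(scaler_nat 2 T) scalerA mulVf ?scale1r// pnatr_eq0.
Qed.

Lemma symm_congr N (L T : 'M[R]_N) :
  symm (L^T *m T *m L) = L^T *m symm T *m L.
Proof.
by rewrite /symm !trmx_mul trmxK -scalemxAr -scalemxAl mulmxDr mulmxDl mulmxA.
Qed.

(** In the trace pairing, a symmetric matrix is orthogonal to the antisymmetric part of [T]. *)
Lemma tr_symm N (T Y : 'M[R]_N) : Y^T = Y -> \tr (T^T *m Y) = \tr (symm T *m Y).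
Proof.
move=> YT; have h : \tr (T *m Y) = \tr (T^T *m Y).
  by rewrite -mxtrace_tr trmx_mul YT mxtrace_mulC.
rewrite /symm -scalemxAl mxtraceZ mulmxDl mxtraceD h -mulr2n.
by rewrite -[X in _ = _ * X](mulr_natl _ 2) mulKf// pnatr_eq0.
Qed.

Lemma big_mxvec n m (F : 'I_(n * m) -> R) :
  \sum_p F p = \sum_i \sum_j F (mxvec_index i j).
Proof.
by rewrite (reindex _ (curry_mxvec_bij _ _)) pair_bigA /=; apply: eq_bigr => -[].
Qed.

Lemma mxvec_pairing N (X T : 'M[R]_N) :
  (mxvec X *m (mxvec T)^T) 0 0 = \tr (X^T *m T).
Proof.
rewrite mxE big_mxvec exchange_big /=; apply: eq_bigr => j _; rewrite mxE; apply: eq_bigr => i _.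
by rewrite mxE !mxvecE mxE.
Qed.

Lemma symkron_mxvec N (W T : 'M[R]_N) :
  symkron W *m (mxvec T)^T = (mxvec (symm (W *m T *m W^T)))^T.
Proof.
apply/colP => p; rewrite mxE; case/mxvec_indexP: p => i j.
rewrite mxE mxvecE big_mxvec.
have WE a b : (W *m T *m W^T) a b = \sum_k \sum_l W a k * W b l * T k l.
  rewrite mxE exchange_big /=; apply: eq_bigr => l _; rewrite !mxE big_distrl /=.
  by apply: eq_bigr => k _; rewrite mulrAC.
rewrite symmE !WE -big_split big_distrr /=; apply: eq_bigr => k _.
rewrite -big_split big_distrr /=; apply: eq_bigr => l _.
by rewrite symkronE mxE mxvecE; ring.
Qed.

(* The variance of [\tr (X^T *m T)] when [mxvec X] has covariance [symkron W]. *)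
Definition symkron_form N (W T : 'M[R]_N) : R :=
  \tr (symm T *m W *m symm T *m W).

Lemma symkron_formE N (W T : 'M[R]_N) : W^T = W ->
  dot (mxvec T)^T (symkron W *m (mxvec T)^T) = symkron_form W T.
Proof.
move=> WT; rewrite symkron_mxvec /dot trmxK mxvec_pairing tr_symm ?symm_tr//.
rewrite WT -{1}WT symm_congr WT /symkron_form !mulmxA.
by [].
Qed.

(** Pythagoras: for the bilinear form behind [symkron_form], the map sending [T] to [P^T *m T *m P]
    is an orthogonal projection. Both cross terms equal the square term because
    [P *m W *m P^T = P *m W]. This is what makes the variances add up to that of the prior. *)
Lemma symkron_form_projection N (W P T : 'M[R]_N) :
  P *m P = P -> P *m W = W *m P^T ->
  symkron_form W (T - P^T *m T *m P) + symkron_form W (P^T *m T *m P) =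
  symkron_form W T.
Proof.
move=> PP PW; rewrite /symkron_form.
have -> : symm (T - P^T *m T *m P) = symm T - P^T *m symm T *m P.
  rewrite -symm_congr /symm trmxD trmxN -scalerBr; congr (_ *: _).
  by rewrite opprD addrACA.
rewrite symm_congr; set S := symm T; set V := P^T *m S *m P.
have VV : \tr (V *m W *m V *m W) = \tr (S *m (P *m W) *m S *m (P *m W)).
  have PWP : P *m W *m P^T = P *m W by rewrite -mulmxA -PW mulmxA PP.
  have -> : V *m W *m V *m W =
      P^T *m (S *m (P *m W *m P^T) *m S *m (P *m W)) by rewrite !mulmxA.
  by rewrite mxtrace_mulC -[X in \tr X = _]mulmxA !PWP.
have SV : \tr (S *m W *m V *m W) = \tr (S *m (P *m W) *m S *m (P *m W)).
  by rewrite /V PW !mulmxA -(mulmxA _ P W) PW !mulmxA.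
have VS : \tr (V *m W *m S *m W) = \tr (S *m W *m V *m W).
  by rewrite -mulmxA mxtrace_mulC mulmxA.
have h : (S - V) *m W *m (S - V) *m W = S *m W *m S *m W - S *m W *m V *m W
    - V *m W *m S *m W + V *m W *m V *m W.
  rewrite [_ *m (S - V)]mulmxBr !mulmxBl opprB addrA.
  by rewrite [LHS]addrAC; congr (_ + _); exact: addrAC.
by rewrite h !(mxtraceD, raddfN) /= VS SV VV; ring.
Qed.

End linear_algebra.

(** * Normal laws on the line *)

(** The pushforward bundled with its measure structure, the measurability of [f] being an explicit
    argument. *)
Definition image_measure d1 d2 (T1 : measurableType d1) (T2 : measurableType d2)
    (R : realType) (m : {measure set T1 -> \bar R}) (f : T1 -> T2)
    (mf : measurable_fun setT f) : {measure set T2 -> \bar R} :=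
  measure_function_pushforward__canonical__measure_function_Measure m mf.

Section normal_law.
Variable R : realType.
Local Notation leb := (@lebesgue_measure R).

Lemma measurable_affine (a b : R) : measurable_fun setT (fun x : R => a * x + b).
Proof. by apply: measurable_funD => //; exact: measurable_funM. Qed.

(** By uniqueness of Lebesgue measure, it suffices to compare the rescaled image measure on
    half-open intervals. *)
Lemma affine_lebesgue (a b : R) (A : set R) : a != 0 -> measurable A ->
  leb A = (`|a|%:E * leb ((fun x => a * x + b)%R @^-1` A))%E.
Proof.
move=> a0 mA.
pose phi : measurableTypeR R -> measurableTypeR R := fun x => a * x + b.
have mphi : measurable_fun setT phi by exact: measurable_affine.
transitivity (mscale `|a|%:nng (image_measure leb mphi) A) => //.
apply: lebesgue_measure_unique => // _ [[u v]] _ <-.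
rewrite -[RHS]/(`|a|%:E * leb (phi @^-1` `]u, v]))%E.
have [a_gt0|a_le0] := ltP 0 a.
  have -> : phi @^-1` `]u, v] = `](u - b) / a, (v - b) / a]%classic.
    apply/seteqP; split => x /=; rewrite !in_itv/= ltr_pdivrMr// ler_pdivlMr//;
      by rewrite ltrBlDr lerBrDr (mulrC x).
  rewrite !lebesgue_measure_itv/= !lte_fin ltr_pM2r ?invr_gt0// ltrD2r.
  case: ifPn => _; last by rewrite mule0.
  by rewrite -!EFinB -EFinM (gtr0_norm a_gt0); congr EFin; field.
(* A negative slope moves the closed end of the interval to the left, without changing its
   length. *)
have {a_le0}a_lt0 : a < 0 by rewrite lt_neqAle a0.
have -> : phi @^-1` `]u, v] = `[(v - b) / a, (u - b) / a[%classic.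
  apply/seteqP; split => x /=; rewrite !in_itv/= ltr_ndivlMr// ler_ndivrMr//;
    by rewrite ltrBlDr lerBrDr (mulrC x) andbC.
rewrite !lebesgue_measure_itv/= !lte_fin ltr_nM2r ?invr_lt0// ltrD2r.
case: ifPn => _; last by rewrite mule0.
by rewrite -!EFinB -EFinM (ltr0_norm a_lt0); congr EFin; field.
Qed.

Lemma normal_pdf_affine (a b m s x : R) : a != 0 -> s != 0 ->
  normal_pdf m s x = `|a| * normal_pdf (a * m + b) (`|a| * s) (a * x + b).
Proof.
move=> a0 s0; rewrite !normal_pdfE ?mulf_neq0 ?normr_eq0//.
rewrite /normal_peak /normal_fun exprMn real_normK ?num_real// mulrA.
congr (_ * _).
  have -> : a ^+ 2 * s ^+ 2 * pi *+ 2 = a ^+ 2 * (s ^+ 2 * pi *+ 2) by ring.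
  rewrite sqrtrM ?sqr_ge0// sqrtr_sqr invfM mulrA.
  by rewrite divff ?mul1r// normr_eq0.
congr expR; rewrite -[_ *+ 2]mulr_natr -[in RHS]mulr_natr.
have -> : a * x + b - (a * m + b) = a * (x - m) by ring.
by field; rewrite s0 a0.
Qed.

(** Change of variables: Lebesgue measure is replaced by its rescaled affine image, and the
    densities match pointwise. *)
Lemma normal_prob_affine (a b m s : R) (A : set R) : a != 0 -> s != 0 ->
  measurable A -> normal_prob m s ((fun x => a * x + b) @^-1` A) =
  normal_prob (a * m + b) (`|a| * s) A.
Proof.
move=> a0 s0 mA; rewrite /normal_prob.
pose phi : measurableTypeR R -> measurableTypeR R := fun x => a * x + b.
have mphi : measurable_fun setT phi by exact: measurable_affine.
have mpdf (u v : R) D : measurable_fun D (fun x => (normal_pdf u v x)%:E).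
  by apply/measurable_funTS/measurable_EFinP; exact: measurable_normal_pdf.
pose k : {nonneg R} := NngNum (normr_ge0 a).
have -> : (\int[leb]_(x in A) (normal_pdf (a * m + b)%R (`|a|%R * s)%R x)%:E =
  \int[mscale k (image_measure leb mphi)]_(x in A)
     (normal_pdf (a * m + b)%R (`|a|%R * s)%R x)%:E)%E.
  apply: eq_measure_integral => B mB _; exact: affine_lebesgue.
have mq := mpdf (a * m + b) (`|a| * s) A.
rewrite ge0_integral_mscale//; last by move=> x _; rewrite lee_fin normal_pdf_ge0.
rewrite (ge0_integral_pushforward mphi _ mA mq); last first.
  by move=> x _; rewrite lee_fin normal_pdf_ge0.
rewrite -ge0_integralZl//=.
- apply: eq_integral => x _; rewrite -EFinM; congr EFin.
  by rewrite (normal_pdf_affine b _ _ a0 s0).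
- by rewrite -[X in measurable X]setTI; exact: mphi.
- by apply: measurable_funTS; apply: (measurableT_comp (mpdf _ _ _)).
- by move=> x _; rewrite lee_fin normal_pdf_ge0.
Qed.

(** The density [p] gives absolute continuity, so the Radon-Nikodym change of variables applies. *)
Lemma ge0_integral_density (Q : probability (measurableTypeR R) R) (p : R -> R)
    (f : R -> \bar R) : measurable_fun setT p -> (forall x, 0 <= p x) ->
  (forall V, measurable V -> Q V = \int[lebesgue_measure]_(x in V) (p x)%:E)%E ->
  measurable_fun setT f -> (forall x, 0 <= f x)%E ->
  (\int[Q]_x f x = \int[lebesgue_measure]_x (f x * (p x)%:E))%E.
Proof.
move=> mp p0 Qp mf f0.
have mpE : measurable_fun setT (EFin \o p) by exact/measurable_EFinP.
have dom : Q `<< @lebesgue_measure R.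
  apply/null_content_dominatesP => A mA A0; rewrite Qp//.
  apply: null_set_integral => //; exact: measurable_funTS.
rewrite -(Radon_Nikodym_SigmaFinite.change_of_variables dom)//.
have intf := Radon_Nikodym_SigmaFinite.f_integrable dom.
apply: ae_eq_integral => //.
- by apply: emeasurable_funM => //; exact: measurable_int intf.
- exact: emeasurable_funM.
(* The Radon-Nikodym derivative and [p] have the same integral over every measurable set, hence
   agree almost everywhere. *)
- apply: ae_eqe_mul2l => /=; apply: integral_ae_eq => // E _ mE.
  rewrite -(Radon_Nikodym_SigmaFinite.f_integral dom mE); exact: Qp.
Qed.

Lemma ge0_integral_normal_prob (m s : R) (f : R -> \bar R) :
  measurable_fun setT f -> (forall x, 0 <= f x)%E ->
  (\int[normal_prob m s]_x f x = \int[leb]_x (f x * (normal_pdf m s x)%:E))%E.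
Proof.
move=> mf f0.
pose Q : probability (measurableTypeR R) R := normal_prob m s.
have Qp V : measurable V -> (Q V = \int[leb]_(x in V) (normal_pdf m s x)%:E)%E by [].
exact: (ge0_integral_density (measurable_normal_pdf m s)
  (normal_pdf_ge0 m s) Qp mf f0).
Qed.

(* Completing the square. *)
Lemma normal_pdf_conv (m1 m2 s1 s2 y z : R) : s1 != 0 -> s2 != 0 ->
  normal_pdf (m1 + y) s1 z * normal_pdf m2 s2 y =
  normal_pdf (m1 + m2) (Num.sqrt (s1 ^+ 2 + s2 ^+ 2)) z *
  normal_pdf ((s2 ^+ 2 * (z - m1) + s1 ^+ 2 * m2) / (s1 ^+ 2 + s2 ^+ 2))
    (s1 * s2 / Num.sqrt (s1 ^+ 2 + s2 ^+ 2)) y.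
Proof.
move=> s10 s20.
have s1p : 0 < s1 ^+ 2 by rewrite exprn_even_gt0.
have s2p : 0 < s2 ^+ 2 by rewrite exprn_even_gt0.
have sp : 0 < s1 ^+ 2 + s2 ^+ 2 by rewrite addr_gt0.
have q0 : Num.sqrt (s1 ^+ 2 + s2 ^+ 2) != 0 by rewrite gt_eqF// sqrtr_gt0.
rewrite !normal_pdfE ?mulf_neq0 ?invr_neq0//.
rewrite /normal_peak /normal_fun mulrACA [RHS]mulrACA -!expRD -!invfM.
congr (_^-1 * expR _).
  have pk_ge0 (x : R) : 0 <= x ^+ 2 * pi *+ 2.
    by rewrite mulrn_wge0// mulr_ge0 ?sqr_ge0 ?pi_ge0.
  rewrite -!sqrtrM//.
  rewrite exprMn exprVn exprMn sqr_sqrtr; last exact: ltW.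
  congr Num.sqrt.
  rewrite -!mulrnAr mulrACA [RHS]mulrACA; congr (_ * _).
  by field; rewrite gt_eqF.
rewrite exprMn exprVn exprMn sqr_sqrtr; last exact: ltW.
by field; rewrite ?s10 ?s20 ?gt_eqF.
Qed.

Lemma measurable_normal_pdf2 (m s : R) : s != 0 ->
  measurable_fun setT (fun p : R * R => normal_pdf (m + p.1) s p.2).
Proof.
move=> s0.
rewrite (_ : (fun _ => _) = (fun p : R * R => normal_pdf 0 s (p.2 - (m + p.1)))).
  apply: measurableT_comp; first exact: measurable_normal_pdf.
  by apply: measurable_funB => //; apply: measurable_funD.
apply/funext => p; rewrite !normal_pdfE//; congr (_ * _).
by rewrite /normal_fun subr0.
Qed.

(** With the set moved into the integrand, Tonelli applies on the whole plane. *)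
Lemma normal_prob_mkcond (m s : R) (A : set R) :
  normal_prob m s A = (\int[leb]_z ((normal_pdf m s z)%:E * (\1_A z)%:E))%E.
Proof.
rewrite /normal_prob integral_mkcond/=; apply: eq_integral => z _.
by rewrite patchE /= indicE; case: ifPn => _; rewrite ?mule1 ?mule0.
Qed.

Lemma measurable_normal_prob_mean (m s : R) (A : set R) : s != 0 ->
  measurable A -> measurable_fun setT (fun y => normal_prob (m + y) s A).
Proof.
move=> s0 mA; under eq_fun do rewrite normal_prob_mkcond.
pose F (p : R * R) : \bar R :=
  ((normal_pdf (m + p.1) s p.2)%:E * (\1_A p.2)%:E)%E.
apply: (@measurable_fun_fubini_tonelli_F _ _ _ _ R leb F) => [|p]; last first.
  by rewrite mule_ge0// lee_fin ?normal_pdf_ge0.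
apply: emeasurable_funM.
  by apply/measurable_EFinP; exact: measurable_normal_pdf2.
by apply/measurable_EFinP; apply: measurableT_comp => //; exact: measurable_indic.
Qed.

(** After exchanging the integrals by Tonelli, completing the square leaves a normal density in [y],
    which integrates to 1. *)
Lemma normal_prob_conv (m1 m2 s1 s2 : R) (A : set R) : s1 != 0 -> s2 != 0 ->
  measurable A ->
  (\int[normal_prob m2 s2]_y normal_prob (m1 + y)%R s1 A =
   normal_prob (m1 + m2)%R (Num.sqrt (s1 ^+ 2 + s2 ^+ 2)) A)%E.
Proof.
move=> s10 s20 mA.
have s1p : 0 < s1 ^+ 2 by rewrite exprn_even_gt0.
have s2p : 0 < s2 ^+ 2 by rewrite exprn_even_gt0.
have sp : 0 < s1 ^+ 2 + s2 ^+ 2 by rewrite addr_gt0.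
have q0 : Num.sqrt (s1 ^+ 2 + s2 ^+ 2) != 0 by rewrite gt_eqF// sqrtr_gt0.
pose F (p : R * R) : \bar R :=
  ((normal_pdf (m1 + p.1) s1 p.2)%:E * (\1_A p.2)%:E)%E.
have F0 p : (0 <= F p)%E by rewrite mule_ge0// lee_fin ?normal_pdf_ge0.
have mF : measurable_fun setT F.
  apply: emeasurable_funM.
    by apply/measurable_EFinP; exact: measurable_normal_pdf2.
  by apply/measurable_EFinP; apply: measurableT_comp => //; exact: measurable_indic.
have mG : measurable_fun setT (fun p : R * R => F p * (normal_pdf m2 s2 p.1)%:E)%E.
  apply: emeasurable_funM => //; apply/measurable_EFinP.
  by apply: measurableT_comp => //; exact: measurable_normal_pdf.
rewrite ge0_integral_normal_prob//; first last.
  exact: measurable_normal_prob_mean.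
have E1 y : normal_prob (m1 + y) s1 A = (\int[leb]_z F (y, z))%E.
  exact: normal_prob_mkcond.
under eq_integral do rewrite E1.
under eq_integral => y _.
  rewrite -ge0_integralZr//=; last 2 first.
  - exact: measurableT_comp mF (pair1_measurable y).
  - by rewrite lee_fin normal_pdf_ge0.
  over.
have G0 p : (0 <= F p * (normal_pdf m2 s2 p.1)%:E)%E.
  by rewrite mule_ge0// lee_fin normal_pdf_ge0.
transitivity (\int[leb]_z \int[leb]_y (F (y, z) * (normal_pdf m2 s2 y)%:E))%E.
  exact: (@fubini_tonelli _ _ _ _ R leb leb _ mG G0).
rewrite /normal_prob [RHS]integral_mkcond/=; apply: eq_integral => z _.
rewrite patchE /F /=; case: ifPn => zA; last first.
  by rewrite integral0_eq// => y _; rewrite indicE (negbTE zA) mule0 mul0e.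
under eq_integral => y _.
  rewrite indicE zA mule1 -EFinM normal_pdf_conv// EFinM; over.
rewrite ge0_integralZl//=.
- by rewrite integral_normal_pdf mule1.
- by apply/measurable_EFinP; exact: measurable_normal_pdf.
- by move=> y _; rewrite lee_fin normal_pdf_ge0.
- by rewrite lee_fin normal_pdf_ge0.
Qed.

Lemma normal_law0 (m : R) : normal_law m 0 = \d_m.
Proof. by rewrite /normal_law eqxx. Qed.

Lemma normal_lawE (m v : R) : v != 0 ->
  normal_law m v = normal_prob m (Num.sqrt v).
Proof. by rewrite /normal_law => /negbTE ->. Qed.

Lemma normal_law_affine (a b m v : R) (A : set R) : 0 <= v -> measurable A ->
  normal_law m v ((fun x => a * x + b) @^-1` A) =
  normal_law (a * m + b) (a ^+ 2 * v) A.
Proof.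
move=> v0 mA; have [->|vn0] := eqVneq v 0.
  by rewrite mulr0 !normal_law0 !diracE.
have [->|a0] := eqVneq a 0.
  rewrite expr0n/= mul0r mul0r add0r normal_law0 normal_lawE//.
  (* For slope 0 the map is constant, so the preimage is everything or nothing and the image law is
     the Dirac mass at [b]. *)
  have -> : (fun x : R => 0 * x + b) @^-1` A = if b \in A then setT else set0.
    apply/seteqP; split => x /=; rewrite mul0r add0r.
      by move=> Ab; rewrite mem_set.
    by case: ifPn => //; rewrite inE.
  rewrite diracE; case: ifPn => _; last by rewrite measure0.
  exact: probability_setT.
have sv0 : Num.sqrt v != 0 by rewrite gt_eqF// sqrtr_gt0 lt0r vn0.
have av0 : a ^+ 2 * v != 0 by rewrite mulf_neq0// expf_neq0.
rewrite (normal_lawE _ av0) (normal_lawE _ vn0).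
have -> : Num.sqrt (a ^+ 2 * v) = `|a| * Num.sqrt v.
  by rewrite sqrtrM ?sqr_ge0// sqrtr_sqr.
exact: normal_prob_affine.
Qed.

Definition has_normal_law d (T : measurableType d) (P : probability T R)
    (f : T -> R) (m v : R) : Prop :=
  forall A : set R, measurable A -> P (f @^-1` A) = normal_law m v A.

Lemma has_normal_law_affine d (T : measurableType d) (P : probability T R)
    (f : T -> R) (a b m v : R) : 0 <= v -> has_normal_law P f m v ->
  has_normal_law P (fun w => a * f w + b) (a * m + b) (a ^+ 2 * v).
Proof.
move=> v0 fmv A mA; rewrite -normal_law_affine// -fmv//.
by rewrite -[X in measurable X]setTI; exact: measurable_affine.
Qed.

(** Integrating out the second coordinate leaves the normal probability of [A] with mean shifted by
    [f], a function [h] to be integrated against the law of [f]. A vanishing variance makes one of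
    the two laws a Dirac mass; otherwise this is the convolution of densities. *)
Lemma has_normal_law_indepD d1 d2 (T1 : measurableType d1)
    (T2 : measurableType d2) (P1 : probability T1 R) (P2 : probability T2 R)
    (f : T1 -> R) (g : T2 -> R) (m1 m2 v1 v2 : R) :
  measurable_fun setT f -> measurable_fun setT g -> 0 <= v1 -> 0 <= v2 ->
  has_normal_law P1 f m1 v1 -> has_normal_law P2 g m2 v2 ->
  has_normal_law (P1 \x P2)%E (fun p => f p.1 + g p.2) (m1 + m2) (v1 + v2).
Proof.
move=> mf mg v10 v20 fn gn A mA.
pose h r := normal_law (m2 + r) v2 A.
pose D := (fun r => 1 * r + m2) @^-1` A.
have mD : measurable D.
  by rewrite -[X in measurable X]setTI; exact: measurable_affine.
have hD r : v2 = 0 -> h r = (\1_D r)%:E.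
  move=> v2E; rewrite /h v2E normal_law0 diracE indicE; congr (_%:R%:E).
  by have -> : m2 + r = 1 * r + m2 by rewrite mul1r addrC.
transitivity (\int[P1]_x h (f x))%E.
  rewrite /product_measure1 /=; apply: eq_integral => x _.
  transitivity (P2 ((fun w => 1 * g w + f x) @^-1` A)).
    rewrite /=; congr (P2 _).
    by apply/seteqP; split => w; rewrite /xsection /= inE /= mul1r addrC.
  have := has_normal_law_affine 1 (f x) v20 gn mA.
  by rewrite (mul1r m2) expr1n (mul1r v2).
have h0 r : (0 <= h r)%E.
  by rewrite /h /normal_law; case: ifPn => _; exact: measure_ge0.
have mh : measurable_fun setT h.
  have [v2E|v2n] := eqVneq v2 0.
    rewrite (_ : h = fun r => (\1_D r)%:E); last by apply/funext => r; exact: hD.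
    by apply/measurable_EFinP; exact: measurable_indic.
  rewrite (_ : h = fun r => normal_prob (m2 + r) (Num.sqrt v2) A); last first.
    by apply/funext => r; rewrite /h normal_lawE.
  apply: measurable_normal_prob_mean => //.
  by rewrite gt_eqF// sqrtr_gt0 lt0r v2n.
(* The normal laws live on [measurableTypeR R], whose display differs from that
   of [R]. *)
pose law := @image_measure _ _ T1 (measurableTypeR R) R P1 f mf.
transitivity (\int[law]_r h r)%E.
  by rewrite (@ge0_integral_pushforward _ _ T1 (measurableTypeR R) R f mf).
have [v1E|v1n] := eqVneq v1 0.
  transitivity (\int[\d_(m1 : measurableTypeR R)]_r h r)%E; last first.
    by rewrite integral_dirac// diracT mul1e /h v1E add0r (addrC m1).
  apply: eq_measure_integral => B mB _.
  by have := fn B mB; rewrite v1E normal_law0.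
have s10 : Num.sqrt v1 != 0 by rewrite gt_eqF// sqrtr_gt0 lt0r v1n.
transitivity (\int[normal_prob m1 (Num.sqrt v1)]_r h r)%E.
  apply: eq_measure_integral => B mB _.
  by have := fn B mB; rewrite normal_lawE.
have [v2E|v2n] := eqVneq v2 0.
  under eq_integral do rewrite hD//.
  transitivity (normal_prob m1 (Num.sqrt v1) D).
    by rewrite integral_indic// setIT.
  rewrite -(normal_lawE m1 v1n) (normal_law_affine _ _ _ v10 mA).
  by rewrite v2E addr0 expr1n !mul1r.
have s20 : Num.sqrt v2 != 0 by rewrite gt_eqF// sqrtr_gt0 lt0r v2n.
rewrite /h; under eq_integral do rewrite normal_lawE//.
rewrite normal_prob_conv// normal_lawE; last by rewrite gt_eqF// addr_gt0// lt0r ?v1n ?v2n.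
by rewrite (sqr_sqrtr v10) (sqr_sqrtr v20) (addrC v2) (addrC m2).
Qed.

End normal_law.

(** * Matrix-valued random variables *)

Section matrix_measurability.
Variable R : realType.

Lemma matrix_open_measurable m n (A : set 'M[R]_(m, n)) : open A -> measurable A.
Proof. by move=> oA; apply: sub_sigma_algebra. Qed.

Lemma continuous_matrix_measurable m n (f : 'M[R]_(m, n) -> R) :
  continuous f -> measurable_fun setT f.
Proof.
move=> /continuousP cf.
apply: (measurability _ (RGenOInfty.measurableE R)) => _ [_ [a ->] <-].
by rewrite setTI; apply: matrix_open_measurable; apply: cf; exact: rray_open.
Qed.

Lemma matrix_entry_measurable m n i j :
  measurable_fun setT (fun X : 'M[R]_(m, n) => X i j).
Proof. by apply: continuous_matrix_measurable; exact: coord_continuous. Qed.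

Let box m n (a b : 'M[rat]_(m, n)) : set 'M[R]_(m, n) :=
  [set X | forall i j, ratr (a i j) < X i j < ratr (b i j)].

(** An open set is the union of the boxes with rational corners that it contains. Other boxes are
    replaced by the empty set, so that the countable index set does not depend on [A]. *)
Let open_boxes m n (A : set 'M[R]_(m, n)) : open A ->
  A = \bigcup_(p in [set: 'M[rat]_(m, n) * 'M[rat]_(m, n)])
        (if `[< box p.1 p.2 `<=` A >] then box p.1 p.2 else set0).
Proof.
move=> oA; apply/seteqP; split => [X AX|X [p _]]; last first.
  by case: asboolP => // + Xp; exact.
have /nbhs_ballP[e /= e0 eA] : nbhs X A by exact: open_nbhs_nbhs.
have lo i j : exists q : rat, X i j - e < ratr q < X i j.
  have [|q] := @rat_in_itvoo R (X i j - e) (X i j); first by rewrite gtrBl.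
  by rewrite in_itv/=; exists q.
have hi i j : exists q : rat, X i j < ratr q < X i j + e.
  have [|q] := @rat_in_itvoo R (X i j) (X i j + e); first by rewrite ltrDl.
  by rewrite in_itv/=; exists q.
have [a aP] := choice (fun p : 'I_m * 'I_n => lo p.1 p.2).
have [b bP] := choice (fun p : 'I_m * 'I_n => hi p.1 p.2).
exists (\matrix_(i, j) a (i, j), \matrix_(i, j) b (i, j)) => //=.
rewrite ifT; last first.
  apply/asboolP => Y Ybox; apply: eA; split => // i j; rewrite /ball /=.
  have := Ybox i j; rewrite !mxE => /andP[aY Yb].
  have /andP[aX _] := aP (i, j); have /andP[_ Xb] := bP (i, j).
  rewrite ltr_distlC; apply/andP; split; first exact: lt_trans aY.
  exact: lt_trans Xb.
move=> i j; rewrite !mxE; have /andP[_ ->] := aP (i, j).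
by have /andP[->] := bP (i, j).
Qed.

(** The preimage of an open set is a countable union of preimages of boxes, and each of these is a
    finite intersection of conditions on single entries. *)
Lemma measurable_matrix d (T : measurableType d) m n (f : T -> 'M[R]_(m, n)) :
  (forall i j, measurable_fun setT (fun w => f w i j)) -> measurable_fun setT f.
Proof.
move=> mf; have mE : @measurable _ 'M[R]_(m, n) = <<s open >> by [].
apply: (measurability _ mE) => _ [A oA <-].
rewrite setTI (open_boxes oA) preimage_bigcup.
apply: countable_bigcupT_measurable => // p.
case: ifPn => _; last by rewrite preimage_set0.
rewrite (_ : _ @^-1` _ = \bigcap_(q in [set: 'I_m * 'I_n])
   ((fun w => f w q.1 q.2) @^-1` `]ratr (p.1 q.1 q.2), ratr (p.2 q.1 q.2)[)).
  apply: fin_bigcap_measurable => // q _.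
  by rewrite -[X in measurable X]setTI; exact: mf.
apply/seteqP; split => [w h q _|w h i j]; first by rewrite /= in_itv/=; exact: h.
by have := h (i, j) I; rewrite /= in_itv.
Qed.

Lemma measurable_matrix_entry d (T : measurableType d) m n
    (f : T -> 'M[R]_(m, n)) i j :
  measurable_fun setT f -> measurable_fun setT (fun w => f w i j).
Proof. by move=> mf; apply: (measurableT_comp (matrix_entry_measurable i j)). Qed.

Lemma measurable_mulmx d (T : measurableType d) m n p (f : T -> 'M[R]_(m, n))
    (g : T -> 'M[R]_(n, p)) :
  measurable_fun setT f -> measurable_fun setT g ->
  measurable_fun setT (fun w => f w *m g w).
Proof.
move=> mf mg; apply: measurable_matrix => i j.
under eq_fun do rewrite mxE.
by apply: measurable_sum => k; apply: measurable_funM; exact: measurable_matrix_entry.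
Qed.

Lemma measurable_addmx d (T : measurableType d) m n (f g : T -> 'M[R]_(m, n)) :
  measurable_fun setT f -> measurable_fun setT g ->
  measurable_fun setT (fun w => f w + g w).
Proof.
move=> mf mg; apply: measurable_matrix => i j; under eq_fun do rewrite mxE.
by apply: measurable_funD; exact: measurable_matrix_entry.
Qed.

End matrix_measurability.

(** * First moments of centred normal laws *)

Section normal_moments.
Variable R : realType.
Local Notation leb := (@lebesgue_measure R).

Lemma normal_prob_itv_gt0 (x e : R) : 0 < e ->
  (0 < normal_prob (0 : R) 1 [set z : R | (`|z - x| < e)%R])%E.
Proof.
move=> e0; set I := [set z | _].
have IE : I = `]x - e, x + e[%classic.
  by apply/seteqP; split => z; rewrite /I /= in_itv/= ltr_distl.
have mI : measurable I by rewrite IE; exact: measurable_itv.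
(* On the interval, [z] is at distance at most [|x| + e] from 0, so [c] bounds the standard density
   from below. *)
pose c := normal_peak 1 * expR (- (`|x| + e) ^+ 2 / 2).
have c0 : 0 < c by rewrite mulr_gt0 ?expR_gt0// normal_peak_gt0.
apply: (@lt_le_trans _ _ (\int[leb]_(z in I) c%:E)%E).
  rewrite integral_cst//= IE lebesgue_measure_itv/= lte_fin ifT; last first.
    by rewrite ltrD2l gtrN.
  by rewrite -EFinB -EFinM lte_fin mulr_gt0// subr_gt0 ltrD2l gtrN.
rewrite /normal_prob; apply: ge0_le_integral => //.
- by move=> z _; rewrite lee_fin ltW.
- by apply/measurable_funTS/measurable_EFinP; exact: measurable_normal_pdf.
- move=> z; rewrite /I /= => zx; rewrite lee_fin normal_pdfE ?oner_eq0//.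
  rewrite ler_pM2l ?normal_peak_gt0 ?oner_eq0// ler_expR subr0 expr1n.
  rewrite !mulNr lerN2 ler_pM2r ?invr_gt0// -[z ^+ 2]real_normK ?num_real//.
  rewrite lerXn2r ?nnegrE ?addr_ge0 ?(ltW e0)//.
  rewrite -lerBlDl (le_trans (lerB_dist _ _))// ltW//.
Qed.

(** The factor [|x|] is absorbed by doubling the variance: with [u = x ^+ 2 / (4 * s ^+ 2)],
    completing the square gives [|x| <= s * (1 + u) <= s * expR u]. *)
Lemma normal_pdf_abs_le (s x : R) : 0 < s ->
  `|x| * normal_pdf 0 s x <=
  s * normal_peak s / normal_peak (Num.sqrt 2 * s) *
    normal_pdf 0 (Num.sqrt 2 * s) x.
Proof.
move=> s0; have q0 : (0 : R) < Num.sqrt 2 by rewrite sqrtr_gt0.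
have qs0 : 0 < Num.sqrt 2 * s by rewrite mulr_gt0.
rewrite !normal_pdfE ?gt_eqF//.
have pk0 : normal_peak (Num.sqrt 2 * s) != 0 by rewrite gt_eqF// normal_peak_gt0// gt_eqF.
rewrite mulrA [leRHS]mulrA divfK// (mulrC `|x|) (mulrC s) -!mulrA.
rewrite ler_pM2l ?normal_peak_gt0 ?gt_eqF//.
rewrite /normal_fun !subr0 exprMn sqr_sqrtr//.
set u := x ^+ 2 / (4 * s ^+ 2).
have -> : - x ^+ 2 / (s ^+ 2 *+ 2) = - u + - u by rewrite /u; field; rewrite gt_eqF.
have -> : - x ^+ 2 / (2 * s ^+ 2 *+ 2) = - u by rewrite /u; field; rewrite gt_eqF.
rewrite expRD mulrA ler_pM2r ?expR_gt0// -ler_pdivlMr ?expR_gt0// -expRN opprK.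
apply: (@le_trans _ _ (s * (1 + u))); last by rewrite ler_pM2l// expR_ge1Dx.
rewrite -subr_ge0.
have -> : s * (1 + u) - `|x| = s * (1 - `|x| / (2 * s)) ^+ 2.
  by rewrite /u -[x ^+ 2]real_normK ?num_real//; field; rewrite gt_eqF.
by rewrite mulr_ge0 ?sqr_ge0 ?ltW.
Qed.

(** After transport to the line, the integrand is dominated by a multiple of the normal density of
    doubled variance. *)
Lemma has_normal_law_integrable d (T : measurableType d) (P : probability T R)
    (f : T -> R) (v : R) : measurable_fun setT f -> 0 <= v ->
  has_normal_law P f 0 v -> P.-integrable setT (EFin \o f).
Proof.
move=> mf v0 fv; apply/integrableP; split; first exact/measurable_EFinP.
pose law := @image_measure _ _ T (measurableTypeR R) R P f mf.
have mabs : measurable_fun setT (fun r : measurableTypeR R => (`|r|)%:E).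
  by apply/measurable_EFinP; exact: normr_measurable.
have -> : (\int[P]_x `|(EFin \o f) x| = \int[law]_r (`|r|%:E))%E.
  by rewrite (@ge0_integral_pushforward _ _ T (measurableTypeR R) R f mf).
have [vE|vn] := eqVneq v 0.
  have -> : (\int[law]_r (`|r|%:E) = \int[\d_(0%R : measurableTypeR R)]_r (`|r|%:E))%E.
    apply: eq_measure_integral => B mB _.
    by have := fv B mB; rewrite vE normal_law0.
  by rewrite integral_dirac// normr0 mule0 ltry.
have s0 : 0 < Num.sqrt v by rewrite sqrtr_gt0 lt0r vn.
have -> : (\int[law]_r (`|r|%:E) = \int[normal_prob 0%R (Num.sqrt v)]_r (`|r|%:E))%E.
  apply: eq_measure_integral => B mB _.
  by have := fv B mB; rewrite normal_lawE.
rewrite ge0_integral_normal_prob//.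
set s := Num.sqrt v in s0 *.
set k := s * normal_peak s / normal_peak (Num.sqrt 2 * s).
apply: (@le_lt_trans _ _ (\int[leb]_r (k%:E * (normal_pdf 0 (Num.sqrt 2 * s)%R r)%:E))%E).
  apply: ge0_le_integral => //.
  - by move=> r _; rewrite mule_ge0// lee_fin normal_pdf_ge0.
  - apply: emeasurable_funM => //.
    by apply/measurable_EFinP; exact: measurable_normal_pdf.
  - apply/measurable_EFinP; apply: measurable_funM => //.
    exact: measurable_normal_pdf.
  - by move=> r _; rewrite -!EFinM lee_fin normal_pdf_abs_le.
have k0 : 0 <= k by rewrite /k !mulr_ge0 ?invr_ge0 ?normal_peak_ge0// ltW.
rewrite ge0_integralZl//.
- by rewrite integral_normal_pdf mule1 ltry.
- by apply/measurable_EFinP; exact: measurable_normal_pdf.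
- by move=> r _; rewrite lee_fin normal_pdf_ge0.
Qed.

(** A centred normal law is symmetric, so the mean equals its opposite; integrability makes it
    finite, hence 0. *)
Lemma has_normal_law_mean0 d (T : measurableType d) (P : probability T R)
    (f : T -> R) (v : R) : measurable_fun setT f -> 0 <= v ->
  has_normal_law P f 0 v -> (\int[P]_x (f x)%:E = 0)%E.
Proof.
move=> mf v0 fv.
have intf := has_normal_law_integrable mf v0 fv.
have nv : has_normal_law P (fun w => -1 * f w + 0) 0 v.
  by have := has_normal_law_affine (-1) 0 v0 fv; rewrite mulr0 addr0 sqrrN expr1n mul1r.
have mg : measurable_fun setT (fun w => -1 * f w + 0).
  by apply: measurable_funD => //; exact: measurable_funM.
have intg := has_normal_law_integrable mg v0 nv.
have E : (\int[P]_x (f x)%:E = \int[P]_x (-1 * f x + 0)%:E)%E.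
  transitivity (\int[image_measure P mf]_r r%:E)%E.
    by rewrite (integral_pushforward mf)//; exact/measurable_EFinP.
  transitivity (\int[image_measure P mg]_r r%:E)%E; last first.
    by rewrite (integral_pushforward mg)//; exact/measurable_EFinP.
  by apply: eq_measure_integral => B mB _; rewrite [LHS]fv// [RHS]nv.
move: E; under [X in _ = X -> _]eq_integral do rewrite addr0 mulN1r EFinN.
rewrite integralN/=; last exact: integrable_add_def.
have : (\int[P]_x (f x)%:E)%E \is a fin_num by exact: integrable_fin_num.
case: (\int[P]_x (f x)%:E)%E => // r _ [] /eqP.
by rewrite -subr_eq0 opprK -mulr2n mulrn_eq0/= => /eqP ->.
Qed.

End normal_moments.

(** * Continuity of matrix operations *)

Section matrix_continuity.
Variables (R : realType) (X : topologicalType).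

Lemma continuous_matrix m n (f : X -> 'M[R]_(m, n)) :
  (forall i j, continuous (fun x => f x i j)) -> continuous f.
Proof.
move=> cf x A [P fxP PA]; apply: (@filterS _ (nbhs x) _
  [set y | forall i j, P i j (f y i j)]); first by move=> y; exact: PA.
apply: filter_forall => i; apply: filter_forall => j.
exact: (cf i j x (P i j) (fxP i j)).
Qed.

Lemma continuous_matrix_entry m n (f : X -> 'M[R]_(m, n)) i j :
  continuous f -> continuous (fun x => f x i j).
Proof.
move=> cf x; apply: (@continuous_comp _ _ _ f (fun M => M i j)); first exact: cf.
exact: coord_continuous.
Qed.

Lemma continuous_sumr n (f : 'I_n -> X -> R) :
  (forall i, continuous (f i)) -> continuous (fun x => \sum_i f i x).
Proof. by move=> cf; apply: continuous_big => //; exact: add_continuous. Qed.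

Lemma continuous_mulmx m n p (f : X -> 'M[R]_(m, n)) (g : X -> 'M[R]_(n, p)) :
  continuous f -> continuous g -> continuous (fun x => f x *m g x).
Proof.
move=> cf cg; apply: continuous_matrix => i j.
under eq_fun do rewrite mxE; apply: continuous_sumr => k x.
by apply: cvgM; exact: continuous_matrix_entry.
Qed.

Lemma continuous_trmx m n (f : X -> 'M[R]_(m, n)) :
  continuous f -> continuous (fun x => (f x)^T).
Proof.
move=> cf; apply: continuous_matrix => i j.
by under eq_fun do rewrite mxE; exact: continuous_matrix_entry.
Qed.

Lemma continuous_addmx m n (f g : X -> 'M[R]_(m, n)) :
  continuous f -> continuous g -> continuous (fun x => f x + g x).
Proof. by move=> cf cg x; apply: cvgD; [exact: cf|exact: cg]. Qed.

Lemma continuous_scalemx m n (a : R) (f : X -> 'M[R]_(m, n)) :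
  continuous f -> continuous (fun x => a *: f x).
Proof. by move=> cf x; apply: cvgZr; exact: cf. Qed.

End matrix_continuity.

(** * Construction of Gaussian matrices *)

Section gaussian_existence.
Variable R : realType.

Lemma eq_has_normal_law d (T : measurableType d) (P : probability T R)
    (f g : T -> R) (m v : R) : f =1 g ->
  has_normal_law P f m v -> has_normal_law P g m v.
Proof. by move=> /funext ->. Qed.

(** Induction on the dimension, with one independent standard normal coordinate put in front. The
    last clause, full support, is used later to condition on a single value. *)
Lemma standard_gaussian_exists n :
  exists d (T : measurableType d) (P : probability T R) (e : T -> 'rV[R]_n),
  [/\ measurable_fun setT e,
      forall t : 'cV[R]_n, has_normal_law P (fun w => (e w *m t) 0 0) 0 (dot t t)
    & forall U : set 'rV[R]_n, open U -> U !=set0 -> (0 < P (e @^-1` U))%E].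
Proof.
(* Every nonempty open set contains a cube, and on cubes the positivity passes to products. *)
suff [d [T [P [e [me eN eS]]]]] : exists d (T : measurableType d)
    (P : probability T R) (e : T -> 'rV[R]_n),
    [/\ measurable_fun setT e,
      forall t : 'cV[R]_n, has_normal_law P (fun w => (e w *m t) 0 0) 0 (dot t t)
    & forall (x : 'rV[R]_n) (eps : R), 0 < eps ->
      (0 < P [set w | forall j, (`|e w 0 j - x 0 j| < eps)%R])%E].
  exists d, T, P, e; split => // U oU [x Ux].
  have /nbhs_ballP[eps /= eps0 epsU] : nbhs x U by exact: open_nbhs_nbhs.
  apply: lt_le_trans (eS x eps eps0) _; apply: le_measure; rewrite ?inE.
  - rewrite (_ : [set _ | _] = \bigcap_(j in [set: 'I_n])
       ((fun w => e w 0 j) @^-1` `]x 0 j - eps, x 0 j + eps[)).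
      apply: fin_bigcap_measurable => // j _.
      rewrite -[X in measurable X]setTI; apply: measurable_matrix_entry => //.
    apply/seteqP; split => [w h j _|w h j]; rewrite /= ?in_itv/= -?ltr_distl//.
    by have := h j I; rewrite /= in_itv/= ltr_distl.
  - by rewrite -[X in measurable X]setTI; apply: me => //; exact: matrix_open_measurable.
  - move=> w h; apply: epsU; split => // i j.
    by rewrite /ball /= ord1 distrC; exact: h.
elim: n => [|n [d [T [P [e [me eN eS]]]]]].
  exists _, unit, (\d_tt : probability unit R), (fun _ => 0); split.
  - exact: measurable_cst.
  - move=> t A mA; rewrite dotE big_ord0 normal_law0.
    rewrite (_ : (fun _ => _) @^-1` A = (fun=> 0) @^-1` A); last first.
      by congr (_ @^-1` A); apply/funext => w; rewrite mul0mx mxE.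
    by rewrite !diracE; congr (_%:R%:E); apply/idP/idP; rewrite !inE.
  - move=> x eps e0; rewrite (_ : [set _ | _] = setT).
      by rewrite (@probability_setT _ _ R (\d_tt : probability unit R)) lte01.
    by apply/seteqP; split => // w _ [].
pose P1 : probability (measurableTypeR R) R := normal_prob 0 1.
exists _, (measurableTypeR R * T)%type, (P1 \x P)%E.
exists (fun p => row_mx (const_mx (p.1 : R)) (e p.2) : 'rV[R]_(1 + n)).
split.
- apply: (@measurable_matrix R _ _ 1 (1 + n)) => i j; case: (@split_ordP 1 n j) => k ->.
    under eq_fun do rewrite row_mxEl ord1 mxE.
    exact: measurable_fst.
  under eq_fun do rewrite row_mxEr.
  apply: measurable_matrix_entry; apply: measurableT_comp => //.
- move=> t; rewrite -[n.+1]/(1 + n)%N in t *.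
  rewrite -(vsubmxK t); set t0 := usubmx t; set t1 := dsubmx t.
  have N1 : has_normal_law P1 (fun x : R => t0 0 0 * x + 0) 0 (t0 0 0 ^+ 2).
    have id1 : has_normal_law P1 (fun x : R => x) 0 1.
      by move=> A mA; rewrite (normal_lawE _ (oner_neq0 R)) sqrtr1.
    have := has_normal_law_affine (t0 0 0) 0 ler01 id1.
    by rewrite mulr0 addr0 mulr1.
  have m1 : measurable_fun setT (fun x : measurableTypeR R => t0 0 0 * x + 0).
    exact: measurable_affine.
  have m2 : measurable_fun setT (fun w => (e w *m t1) 0 0).
    by apply: measurable_matrix_entry; apply: measurable_mulmx.
  have := has_normal_law_indepD m1 m2 (sqr_ge0 _) (dot_ge0 _) N1 (eN t1).
  rewrite addr0.
  have -> : dot (col_mx t0 t1) (col_mx t0 t1) = t0 0 0 ^+ 2 + dot t1 t1.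
    by rewrite /dot tr_col_mx mul_row_col !mxE big_ord1 !mxE expr2.
  apply: eq_has_normal_law => -[x w] /=.
  rewrite mul_row_col [RHS]mxE; congr (_ + _).
  by rewrite [RHS]mxE big_ord1 [const_mx _ _ _]mxE addr0 mulrC.
- move=> x eps e0; rewrite -[n.+1]/(1 + n)%N in x *; rewrite -(hsubmxK x).
  set x0 := lsubmx x; set x1 := rsubmx x.
  rewrite (_ : [set _ | _] = [set z : measurableTypeR R | (`|z - x0 0 0| < eps)%R] `*`
      [set w | forall j, (`|e w 0 j - x1 0 j| < eps)%R]); last first.
    apply/seteqP; split => [[z w] /= h|[z w] /= [h0 h1] j]; first split.
    + by have := h (lshift n 0); rewrite !row_mxEl mxE.
    + by move=> j; have := h (rshift 1 j); rewrite !row_mxEr.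
    case: (@split_ordP 1 n j) => k ->; first by rewrite !row_mxEl ord1 mxE.
    by rewrite !row_mxEr.
  set I0 := [set z | _]; set I1 := [set w | _].
  have PE : product_measure1 P1 P (I0 `*` I1) = (P1 I0 * P I1)%E.
    apply: product_measure1E.
    + rewrite (_ : I0 = `]x0 0 0 - eps, x0 0 0 + eps[%classic).
        exact: measurable_itv.
      by apply/seteqP; split => z; rewrite /I0 /= in_itv/= ltr_distl.
    rewrite (_ : I1 = \bigcap_(j in [set: 'I_n])
       ((fun w => e w 0 j) @^-1` `]x1 0 j - eps, x1 0 j + eps[)).
      apply: fin_bigcap_measurable => // j _.
      rewrite -[X in measurable X]setTI; apply: measurable_matrix_entry => //.
    apply/seteqP; split => [w h j _|w h j]; rewrite /I1 /= ?in_itv/= -?ltr_distl//.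
    by have := h j I; rewrite /= in_itv/= ltr_distl.
  apply: (@lt_le_trans _ _ (product_measure1 P1 P (I0 `*` I1))) => //.
  rewrite PE; apply: mule_gt0; last exact: eS.
  exact: normal_prob_itv_gt0.
Qed.

Lemma mxtrace_symm_transfer N (H Q : 'M[R]_N) :
  \tr (symm H *m Q) = \tr (H^T *m symm Q).
Proof.
rewrite (tr_symm _ (symm_tr Q)) [RHS]mxtrace_mulC -(tr_symm _ (symm_tr H)).
by rewrite -mxtrace_tr trmx_mul symm_tr.
Qed.

(** With [W = L *m L^T] and a standard Gaussian matrix [E], take [L *m symm E *m L^T]: its pairing
    with [A] is the pairing of [E] with [symm (L^T *m A *m L)]. The support consists of symmetric
    matrices, so positivity is claimed only for open sets that contain one. *)
Lemma symmetric_gaussian_exists N (W : 'M[R]_N) : posdef W ->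
  exists d (T : measurableType d) (P : probability T R) (X : T -> 'M[R]_N),
  [/\ measurable_fun setT X,
      forall w, (X w)^T = X w,
      forall A : 'M[R]_N,
        has_normal_law P (fun w => \tr ((X w)^T *m A)) 0 (symkron_form W A)
    & forall (U : set 'M[R]_N) (A : 'M[R]_N), open U -> U A -> A^T = A ->
        (0 < P (X @^-1` U))%E].
Proof.
move=> Wpos; have [L WE] := posdef_cholesky Wpos.
have [d [T [P [e [me eN eS]]]]] := standard_gaussian_exists (N * N).
pose lin (h : 'rV[R]_(N * N)) := L *m symm (vec_mx h) *m L^T.
have clin : continuous lin.
  apply: continuous_mulmx; last exact: cst_continuous.
  apply: continuous_mulmx; first exact: cst_continuous.
  have cv : continuous (@vec_mx R N N).
    apply: continuous_matrix => i j; under eq_fun do rewrite mxE.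
    exact: coord_continuous.
  by apply: continuous_scalemx; apply: continuous_addmx; [exact: cv|exact: continuous_trmx].
exists d, T, P, (lin \o e); split.
- apply: measurableT_comp => //; apply: measurable_matrix => i j.
  apply: continuous_matrix_measurable; exact: continuous_matrix_entry.
- by move=> w; rewrite /lin /= !trmx_mul trmxK symm_tr mulmxA.
- move=> A; pose Q := L^T *m A *m L.
  have -> : symkron_form W A = dot (mxvec (symm Q))^T (mxvec (symm Q))^T.
    rewrite /dot trmxK mxvec_pairing symm_tr symm_congr /symkron_form WE.
    by rewrite !mulmxA mxtrace_mulC !mulmxA.
  apply: eq_has_normal_law (eN _) => w.
  rewrite -{1}(vec_mxK (e w)) mxvec_pairing -mxtrace_symm_transfer /Q /=.
  by rewrite /lin !trmx_mul trmxK symm_tr -[in RHS]mulmxA [RHS]mxtrace_mulC !mulmxA.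
move=> U A oU UA AT; rewrite comp_preimage; apply: eS.
  by move/continuousP: clin; exact.
(* A row vector killed by [L] would have quadratic form 0 under [W]. *)
have Lu : L \in unitmx.
  rewrite unitmxE unitfE; apply/negP => /eqP dL.
  have /det0P[v v0 vL] : \det L == 0 by apply/eqP.
  have := Wpos.2 v^T; rewrite trmx_eq0 v0 => /(_ isT).
  by rewrite WE /dot trmxK !mulmxA vL !mul0mx mxE ltxx.
(* This vector is a preimage of [A] under [lin]. *)
exists (mxvec (invmx L *m A *m (invmx L)^T)).
rewrite /= /lin mxvecK symm_id; last by rewrite !trmx_mul trmxK AT mulmxA.
rewrite !mulmxA mulmxV// mul1mx -mulmxA -trmx_mul mulmxV// trmx1 mulmx1.
exact: UA.
Qed.

End gaussian_existence.

(** * Integration against a conditional distribution *)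

Section disintegration.
Context (R : realType) d (T : measurableType d) (P : probability T R).
Context dX (TX : measurableType dX) dY (TY : measurableType dY).
Variables (Y : T -> TY) (k : R.-pker TY ~> TX).
Hypothesis mY : measurable_fun setT Y.

(** The law of the pair formed by [Y w] and a point drawn from [k (Y w)]. The dummy [unit] factor
    gives the shape required for composing kernels. *)
Definition graph_kernel (p : unit * T) : {measure set (TY * TX) -> \bar R} :=
  image_measure (k (Y p.2)) (pair1_measurable (Y p.2)).

Let measurable_graph_kernel U : measurable U ->
  measurable_fun setT (graph_kernel ^~ U).
Proof.
move=> mU.
rewrite (_ : (fun _ => _) = (fun u => k u (xsection U u)) \o (fun p : unit * T => Y p.2)).
  apply: measurableT_comp.
    by apply: measurable_fun_xsection_finite_kernel; rewrite inE.
  exact: measurableT_comp.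
apply/funext => p; rewrite /graph_kernel /= /pushforward; congr (k _ _).
by apply/seteqP; split => x; rewrite /xsection /= inE.
Qed.

HB.instance Definition _ := isKernel.Build _ _ _ _ R graph_kernel
  measurable_graph_kernel.

Let graph_kernel_prob p : graph_kernel p setT = 1%E.
Proof. exact: prob_kernel. Qed.

HB.instance Definition _ := Kernel_isProbability.Build _ _ _ _ R graph_kernel
  graph_kernel_prob.

(** The definition of [cond_distribution] says that the joint law of [Y] and [X] and the composed
    kernel agree on rectangles. These are stable under intersection and generate the product
    sigma-algebra, so the two measures coincide. *)
Lemma ge0_integral_cond_distribution (X : T -> TX) (F : TY * TX -> \bar R) :
  measurable_fun setT X -> cond_distribution P X Y k ->
  measurable_fun setT F -> (forall z, 0 <= F z)%E ->
  (\int[P]_w F (Y w, X w) = \int[P]_w \int[k (Y w)]_x F (Y w, x))%E.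
Proof.
move=> mX cd mF F0.
have mYX : measurable_fun setT (fun w => (Y w, X w)) by exact/measurable_fun_pairP.
pose l : R.-pker unit ~> T := kprobability (measurable_cst (P : pprobability T R)).
transitivity (\int[image_measure P mYX]_z F z)%E.
  by rewrite (ge0_integral_pushforward mYX).
transitivity (\int[mkcomp l graph_kernel tt]_z F z)%E; last first.
  rewrite (integral_kcomp l graph_kernel tt F0 mF); apply: eq_integral => w _.
  rewrite /graph_kernel (ge0_integral_pushforward (pair1_measurable (Y w)))//.
apply: eq_measure_integral => D mD _.
pose C : set (set (TY * TX)) :=
  [set D | exists A, measurable A /\ exists B, measurable B /\ D = A `*` B].
apply: (@measure_unique _ _ _ C (fun=> setT)) mD => //.
- rewrite measurable_prod_measurableType //; congr (<<s _ >>).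
  rewrite predeqE; split => [[A mA [B mB <-]]|[A [mA [B [mB ->]]]]].
    by exists A; split => //; exists B.
  by exists A => //; exists B.
- move=> _ _ [X1 [mX1 [X2 [mX2 ->]]]] [Y1 [mY1 [Y2 [mY2 ->]]]].
  rewrite -setXI; exists (X1 `&` Y1); split; first exact: measurableI.
  by exists (X2 `&` Y2); split => //; exact: measurableI.
- move=> _; exists setT; split => //; exists setT; split => //.
  by rewrite setXTT.
- by apply/seteqP; split => // z _; exists 0%N.
- move=> _ [A [mA [B [mB ->]]]].
  transitivity (\int[P]_(w in Y @^-1` A) k (Y w) B)%E.
    rewrite -cd//; rewrite /image_measure /= /pushforward; congr (P _).
    by rewrite setIC; apply/seteqP; split.
  rewrite /mkcomp /kcomp /=; rewrite integral_mkcond; apply: eq_integral => w _.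
  rewrite patchE /= /graph_kernel /pushforward /=; case: ifPn; rewrite ?inE ?notin_setE /= => Aw.
    by congr (k _ _); apply/seteqP; split => // x [].
  by rewrite (_ : _ @^-1` _ = set0) ?measure0//; apply/seteqP; split => // x [].
- by move=> _; rewrite /image_measure /= /pushforward preimage_setT probability_setT ltry.
Qed.

End disintegration.

(** * Transfer of cosine moments *)

Section bounded_integrals.
Variable R : realType.

Lemma bounded_integrable d (T : measurableType d) (P : probability T R)
    (f : T -> R) (K : R) : measurable_fun setT f -> (forall w, `|f w| <= K) ->
  P.-integrable setT (EFin \o f).
Proof.
move=> mf fK; apply: measurable_bounded_integrable => //.
  by rewrite -ge0_fin_numE// fin_num_measure.
exists K; split; first exact: num_real.
by move=> x Kx w _; exact: le_trans (fK w) (ltW Kx).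
Qed.

End bounded_integrals.

(** * Bump functions as mixtures of cosines *)

Section cauchy_bump.
Variable R : realType.
Local Notation leb := (@lebesgue_measure R).

Lemma is_derive_mulr (x t : R) : is_derive t 1 (fun z : R => z * x) x.
Proof.
rewrite (_ : (fun z => z * x) = x \*: id); last first.
  by apply/funext => z; rewrite mulrC.
by apply: is_derive_eq; rewrite /GRing.scale /= mulr1.
Qed.

Definition cauchy_bump (x : R) : R := 1 + (1 + x ^+ 2)^-1.

Lemma cauchy_bump_den_gt0 (x : R) : 0 < 1 + x ^+ 2.
Proof. by rewrite ltr_pwDl// sqr_ge0. Qed.

Lemma cauchy_bump_gt0 x : 0 < cauchy_bump x.
Proof. by rewrite addr_gt0// invr_gt0 cauchy_bump_den_gt0. Qed.

Lemma cauchy_bump_le2 x : cauchy_bump x <= 2.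
Proof.
by rewrite /cauchy_bump -lerBrDl (_ : 2 - 1 = 1); [rewrite invf_le1 ?cauchy_bump_den_gt0// lerDl sqr_ge0|ring].
Qed.

Lemma cauchy_bump0 : cauchy_bump 0 = 2.
Proof. by rewrite /cauchy_bump expr0n/= addr0 invr1. Qed.

Lemma cauchy_bump_le (x e : R) : 0 <= e -> e <= `|x| -> cauchy_bump x <= cauchy_bump e.
Proof.
move=> e0 ex; rewrite /cauchy_bump lerD2l lef_pV2 ?posrE ?cauchy_bump_den_gt0// lerD2l.
by rewrite -[x ^+ 2]real_normK ?num_real// lerXn2r ?nnegrE.
Qed.

Lemma cauchy_bump_lt2 (e : R) : 0 < e -> cauchy_bump e < 2.
Proof.
move=> e0; rewrite /cauchy_bump -ltrBrDl (_ : 2 - 1 = 1); last by ring.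
by rewrite invf_lt1 ?cauchy_bump_den_gt0// ltrDl exprn_gt0.
Qed.

Lemma continuous_cauchy_bump : continuous cauchy_bump.
Proof.
move=> x; apply: cvgD; first exact: cvg_cst.
apply: cvgV; first by rewrite gt_eqF// cauchy_bump_den_gt0.
by apply: cvgD; [exact: cvg_cst|exact: exprn_continuous].
Qed.

(* The exponential distribution has characteristic function with real part
   [1 / (1 + x ^+ 2)]; the constant 1 makes the integrand nonnegative. *)
Lemma cauchy_bumpE (x : R) :
  (\int[exponential_prob (1 : R)]_xi (1 + cos (xi * x))%:E = (cauchy_bump x)%:E)%E.
Proof.
have d0 := cauchy_bump_den_gt0 x.
have mcos : measurable_fun setT (fun xi : R => 1 + cos (xi * x)).
  apply: measurable_funD => //; apply: measurableT_comp.
    by apply: continuous_measurable_fun; exact: continuous_cos.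
  exact: measurable_funM.
have cos1_ge0 xi : 0 <= 1 + cos (xi * x) by rewrite -lerBlDl sub0r cos_geN1.
have mE : measurable_fun setT (fun xi : R => (1 + cos (xi * x))%:E).
  exact/measurable_EFinP.
have E0 xi : (0 <= (1 + cos (xi * x))%:E)%E by rewrite lee_fin.
rewrite (ge0_integral_density (measurable_exponential_pdf (1 : R))
  (exponential_pdf_ge0 ler01) _ mE E0)//.
pose f (xi : R) := (1 + cos (xi * x)) * expR (- xi).
transitivity (\int[leb]_(xi in `[0%R, +oo[) (f xi)%:E)%E.
  rewrite [RHS]integral_mkcond; apply: eq_integral => xi _.
  rewrite /exponential_pdf !patchE; case: ifPn => _; last by rewrite mule0.
  by rewrite -EFinM /f mul1r mulN1r.
(* An explicit antiderivative of [f] that tends to 0 at infinity; the integral is therefore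
   [- F 0]. *)
pose F (xi : R) := expR (- xi) * ((x * sin (xi * x) - cos (xi * x)) / (1 + x ^+ 2) - 1).
have dlin (xi : R) := is_derive_mulr x xi.
have dsin (xi : R) : is_derive xi 1 (fun z : R => sin (z * x)) (cos (xi * x) * x).
  exact: (@is_derive1_comp R sin (fun z => z * x)).
have dcos (xi : R) : is_derive xi 1 (fun z : R => cos (z * x)) (- sin (xi * x) * x).
  exact: (@is_derive1_comp R cos (fun z => z * x)).
have dexp (xi : R) : is_derive xi 1 (fun z : R => expR (- z)) (expR (- xi) * -1).
  exact: (@is_derive1_comp R expR (fun z => - z)).
have dF (xi : R) : is_derive xi 1 F (f xi).
  have D := is_deriveM (dexp xi) (is_deriveB (is_deriveZ (1 + x ^+ 2)^-1
    (is_deriveB (is_deriveZ x (dsin xi)) (dcos xi))) (is_derive_cst (1 : R) xi 1)).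
  rewrite (_ : F = (fun z => expR (- z)) * ((1 + x ^+ 2)^-1 \*:
    (x \*: (fun z => sin (z * x)) - (fun z => cos (z * x))) - cst 1)); last first.
    by apply/funext => z; rewrite /F [in LHS]mulrC [(_ - _) / _]mulrC [in LHS]mulrC.
  apply: is_derive_eq D _.
  rewrite -[LHS]/(expR (- xi) * ((1 + x ^+ 2)^-1 *
      (x * (cos (xi * x) * x) - - sin (xi * x) * x) - 0) +
    ((1 + x ^+ 2)^-1 * (x * sin (xi * x) - cos (xi * x)) - 1) *
      (expR (- xi) * -1)) /f.
  by field; rewrite gt_eqF.
have dcont (g g' : R -> R) : (forall z : R, is_derive z (1 : R) g (g' z)) -> continuous g.
  move=> dg z; apply: differentiable_continuous; apply/derivable1_diffP.
  by have [] := dg z.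
have cF := dcont _ _ dF.
rewrite (@ge0_continuous_FTC2y R f F 0 0).
- rewrite /F !mul0r oppr0 expR0 sin0 cos0 mulr0 -EFinB; congr EFin.
  by rewrite /cauchy_bump; field; rewrite gt_eqF.
- by move=> xi _; rewrite mulr_ge0// expR_ge0.
- apply: continuous_subspaceT => xi; apply: cvgM; last exact: (dcont _ _ dexp).
  by apply: cvgD; [exact: cvg_cst|exact: (dcont _ _ dcos)].
(* The trigonometric factor is bounded by [C], so [F] decays like [expR (- xi)]. *)
- pose C := (`|x| + 1) / (1 + x ^+ 2) + 1.
  have GC xi : `|(x * sin (xi * x) - cos (xi * x)) / (1 + x ^+ 2) - 1| <= C.
    rewrite (le_trans (ler_normB _ _))// normr1 lerD2r normrM.
    rewrite (@ger0_norm _ (_^-1)) ?invr_ge0 ?(ltW d0)// ler_pM2r ?invr_gt0//.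
    rewrite (le_trans (ler_normB _ _))//; apply: lerD.
      by rewrite normrM ler_piMr// ler_norml sin_geN1 sin_le1.
    by rewrite ler_norml cos_geN1 cos_le1.
  have cC : expR (- xi) * C @[xi --> +oo%R] --> (0 : R).
    by rewrite -(mul0r C); apply: cvgM; [exact: cvgr_expR|exact: cvg_cst].
  have cCN : - (expR (- xi) * C) @[xi --> +oo%R] --> (0 : R).
    by rewrite -oppr0; exact: cvgN.
  apply: (squeeze_cvgr _ cCN cC); apply: nearW => xi.
  rewrite -ler_norml /F normrM (@ger0_norm _ (expR _)) ?expR_ge0//.
  by rewrite ler_pM2l ?expR_gt0.
- by move=> xi _; have [] := dF xi.
- by apply: cvg_at_right_filter; exact: cF.
- by move=> xi _; rewrite derive1E; have [_ ->] := dF xi.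
Qed.

End cauchy_bump.

Section cosine_moments.
Variables (R : realType) (N : nat).
Local Notation pairing X A := (\tr (X^T *m A)).

Lemma continuous_pairing (A : 'M[R]_N) : continuous (fun X : 'M[R]_N => pairing X A).
Proof.
apply: continuous_sumr => i; apply: continuous_matrix_entry.
apply: continuous_mulmx; last exact: cst_continuous.
by apply: continuous_trmx => x; exact: cvg_id.
Qed.

Lemma measurable_pairing d (T : measurableType d) (B : T -> 'M[R]_N) (A : 'M[R]_N) :
  measurable_fun setT B -> measurable_fun setT (fun w => pairing (B w) A).
Proof.
move=> mB; apply: (measurableT_comp (f := fun X : 'M[R]_N => pairing X A)) => //.
by apply: continuous_matrix_measurable; exact: continuous_pairing.
Qed.

Lemma measurable_cos : measurable_fun setT (@cos R).
Proof. by apply: continuous_measurable_fun; exact: continuous_cos. Qed.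

Lemma norm_cos_le1 (x : R) : `|cos x| <= 1.
Proof. by rewrite ler_norml cos_geN1 cos_le1. Qed.

(** A real form of the characteristic function weighted by [G]; the phase [th] also produces the
    sine part. *)
Definition cos_moment d (T : measurableType d) (P : probability T R)
    (B : T -> 'M[R]_N) (G : 'M[R]_N -> R) (A : 'M[R]_N) (th : R) : \bar R :=
  (\int[P]_w (G (B w) * cos (pairing (B w) A + th))%:E)%E.

Lemma cos_moment_integrable d (T : measurableType d) (P : probability T R)
    (B : T -> 'M[R]_N) (G : 'M[R]_N -> R) (K : R) (A : 'M[R]_N) (th : R) :
  measurable_fun setT B -> measurable_fun setT G -> (forall X, `|G X| <= K) ->
  P.-integrable setT (EFin \o (fun w => G (B w) * cos (pairing (B w) A + th))).
Proof.
move=> mB mG GK; apply: (@bounded_integrable _ _ _ _ _ K).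
  apply: measurable_funM; first exact: measurableT_comp.
  apply: (measurableT_comp measurable_cos).
  by apply: measurable_funD => //; exact: measurable_pairing.
by move=> w; rewrite normrM -[leRHS]mulr1 ler_pM// norm_cos_le1.
Qed.

(* Writing [cauchy_bump] as a mixture of cosines and linearising the products of
   cosines expresses the moments of [G * cauchy_bump] by those of [G]. *)
Lemma cos_moment_cauchy_bump d (T : measurableType d) (P : probability T R)
    (B : T -> 'M[R]_N) (G : 'M[R]_N -> R) (K : R) (A A0 : 'M[R]_N) (th a : R) :
  measurable_fun setT B -> measurable_fun setT G -> (forall X, `|G X| <= K)%R ->
  (cos_moment P B (fun X : 'M[R]_N => G X * cauchy_bump (pairing X A0 - a))%R A th =
   \int[exponential_prob (1 : R)]_xi
     (cos_moment P B G A th +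
      ((2^-1 : R)%R%:E * cos_moment P B G (A + xi *: A0)%R (th - xi * a)%R +
       (2^-1 : R)%R%:E * cos_moment P B G (A - xi *: A0)%R (th + xi * a)%R)))%E.
Proof.
move=> mB mG GK.
pose F (p : T * measurableTypeR R) := G (B p.1) * cos (pairing (B p.1) A + th) *
  (1 + cos ((p.2 : R) * (pairing (B p.1) A0 - a))).
have K0 : 0 <= K by exact: le_trans (GK 0).
have FK p : `|F p| <= K * 2.
  rewrite /F !normrM ler_pM ?mulr_ge0//.
    by rewrite -[leRHS]mulr1 ler_pM// norm_cos_le1.
  by rewrite (le_trans (ler_normD _ _))// normr1 lerD2l norm_cos_le1.
have mp A1 : measurable_fun setT (fun p : T * measurableTypeR R => pairing (B p.1) A1).
  by apply: measurable_pairing; exact: measurableT_comp.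
have mF : measurable_fun setT F.
  apply: measurable_funM.
    apply: measurable_funM; first by apply: measurableT_comp => //; exact: measurableT_comp.
    by apply: (measurableT_comp measurable_cos); apply: measurable_funD.
  apply: measurable_funD => //; apply: (measurableT_comp measurable_cos).
  by apply: measurable_funM => //; apply: measurable_funB.
pose Q0 : probability (measurableTypeR R) R := exponential_prob (1 : R).
pose Q : probability (measurableTypeR R) R := Q0 ltr01.
have intF : (P \x Q)%E.-integrable setT (EFin \o F) by exact: bounded_integrable mF FK.
have fub := @Fubini _ _ _ _ R P Q (EFin \o F) intF.
transitivity (\int[P]_w \int[Q]_xi (EFin \o F) (w, xi))%E.
  apply: eq_integral => w _; rewrite /F /=.
  under eq_integral do rewrite EFinM.
  rewrite integralZl//=.
    by rewrite cauchy_bumpE -EFinM mulrAC.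
  apply: (@bounded_integrable _ _ _ Q _ 2).
    apply: measurable_funD => //; apply: (measurableT_comp measurable_cos).
    exact: measurable_funM.
  by move=> xi; rewrite (le_trans (ler_normD _ _))// normr1 lerD2l norm_cos_le1.
rewrite fub; apply: eq_integral => xi0 _; pose xi : R := xi0.
have int A1 th1 := cos_moment_integrable P A1 th1 mB mG GK.
have half A1 th1 := integralZl measurableT (int A1 th1) (2^-1).
have ihalf A1 th1 := integrableZl measurableT (2^-1) (int A1 th1).
pose g A1 th1 (w : T) : R := G (B w) * cos (pairing (B w) A1 + th1).
pose g1 := g (A + xi *: A0) (th - xi * a).
pose g2 := g (A - xi *: A0) (th + xi * a).
transitivity (\int[P]_w ((g A th w)%:E +
   ((2^-1)%:E * (g1 w)%:E + (2^-1)%:E * (g2 w)%:E)))%E; last first.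
  rewrite (integralD measurableT (int _ _) (integrableD measurableT (ihalf _ _) (ihalf _ _))).
  by rewrite (integralD measurableT (ihalf _ _) (ihalf _ _)) !half.
apply: eq_integral => w _; rewrite -!EFinM -!EFinD; congr EFin.
  rewrite /F /g1 /g2 /g /= -/xi.
  have lin c : pairing (B w) (A + c *: A0) = pairing (B w) A + c * pairing (B w) A0.
    by rewrite mulmxDr mxtraceD -scalemxAr mxtraceZ.
  have linN c : pairing (B w) (A - c *: A0) = pairing (B w) A - c * pairing (B w) A0.
    by rewrite -scaleNr lin mulNr.
  rewrite [X in cos (X + (th - xi * a))](lin xi).
  rewrite [X in cos (X + (th + xi * a))](linN xi).
  set l := pairing _ A; set l0 := pairing _ A0.
  rewrite (_ : l + xi * l0 + (th - xi * a) = (l + th) + xi * (l0 - a)); last by ring.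
  rewrite (_ : l - xi * l0 + (th + xi * a) = (l + th) - xi * (l0 - a)); last by ring.
  move: (l + th) (xi * (l0 - a)) (G (B w)) => u v c.
  by rewrite cosD cosB; field.
Qed.

Section transfer.
Context d1 (T1 : measurableType d1) (P1 : probability T1 R) (B1 : T1 -> 'M[R]_N).
Context d2 (T2 : measurableType d2) (P2 : probability T2 R) (B2 : T2 -> 'M[R]_N).
Hypotheses (mB1 : measurable_fun setT B1) (mB2 : measurable_fun setT B2).
Hypothesis same_law : forall A (D : set R), measurable D ->
  P1 ((fun w => pairing (B1 w) A) @^-1` D) =
  P2 ((fun w => pairing (B2 w) A) @^-1` D).

(** Without a weight, the integrand depends on one linear functional only, whose law is the same on
    both sides. *)
Lemma cos_moment1_transfer A th :
  cos_moment P1 B1 (cst 1) A th = cos_moment P2 B2 (cst 1) A th.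
Proof.
pose X1 (w : T1) : measurableTypeR R := pairing (B1 w) A.
pose X2 (w : T2) : measurableTypeR R := pairing (B2 w) A.
have mX1 : measurable_fun setT X1 by exact: measurable_pairing.
have mX2 : measurable_fun setT X2 by exact: measurable_pairing.
pose h (x : measurableTypeR R) : \bar R := (1 * cos ((x : R) + th))%:E.
have mh : measurable_fun setT h.
  apply/measurable_EFinP; apply: measurable_funM => //.
  by apply: (measurableT_comp measurable_cos); exact: measurable_funD.
have m1 : measurable_fun [set: 'M[R]_N] (cst (1 : R)) by [].
have le1 (X : 'M[R]_N) : `|cst (1 : R) X| <= 1 by rewrite normr1.
transitivity (\int[image_measure P1 mX1]_x h x)%E.
  rewrite (integral_pushforward mX1 mh _ measurableT)//.
  exact: (cos_moment_integrable P1 A th mB1 m1 le1).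
transitivity (\int[image_measure P2 mX2]_x h x)%E; last first.
  rewrite (integral_pushforward mX2 mh _ measurableT)//.
  exact: (cos_moment_integrable P2 A th mB2 m1 le1).
by apply: eq_measure_integral => D mD _; exact: same_law.
Qed.

(** The bound on [G] keeps the class stable under multiplication by bumps, since it justifies Fubini
    in [cos_moment_cauchy_bump]. *)
Definition transferable (G : 'M[R]_N -> R) := [/\ measurable_fun setT G,
  exists K, forall X, `|G X| <= K
  & forall A th, cos_moment P1 B1 G A th = cos_moment P2 B2 G A th].

Lemma transferable1 : transferable (cst 1).
Proof.
split=> //; first by exists 1 => X; rewrite normr1.
exact: cos_moment1_transfer.
Qed.

Lemma transferable_cauchy_bump G A a : transferable G ->
  transferable (fun X => G X * cauchy_bump (pairing X A - a)).
Proof.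
move=> [mG [K GK] eG]; split.
- apply: measurable_funM => //.
  apply: (measurableT_comp (continuous_measurable_fun (@continuous_cauchy_bump R))).
  by apply: measurable_funB => //; exact: measurable_pairing.
- exists (K * 2) => X; rewrite normrM ler_pM// gtr0_norm ?cauchy_bump_gt0//.
  exact: cauchy_bump_le2.
- move=> A1 th; rewrite (cos_moment_cauchy_bump P1 A1 A th a mB1 mG GK).
  rewrite (cos_moment_cauchy_bump P2 A1 A th a mB2 mG GK).
  by congr (integral _ _ _); apply/funext => xi; rewrite !eG.
Qed.

Lemma transferable_prod_cauchy_bump G n (A : 'I_n -> 'M[R]_N) (a : 'I_n -> R) :
  transferable G ->
  transferable (fun X => G X * \prod_i cauchy_bump (pairing X (A i) - a i)).
Proof.
elim: n A a => [|n IH] A a tG.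
  rewrite (_ : (fun _ => _) = G)//; apply/funext => X.
  by rewrite big_ord0 mulr1.
rewrite (_ : (fun _ => _) = fun X => (G X *
  \prod_(i < n) cauchy_bump (pairing X (A (widen_ord (leqnSn n) i)) - a (widen_ord (leqnSn n) i))) *
  cauchy_bump (pairing X (A ord_max) - a ord_max)); last first.
  by apply/funext => X; rewrite big_ord_recr mulrA.
exact/transferable_cauchy_bump/IH.
Qed.

Lemma transferable_exp n k (A : 'I_n -> 'M[R]_N) (a : 'I_n -> R) :
  transferable (fun X => (\prod_i cauchy_bump (pairing X (A i) - a i)) ^+ k).
Proof.
elim: k => [|k IH]; first exact: transferable1.
rewrite (_ : (fun _ => _) = fun X => (\prod_i cauchy_bump (pairing X (A i) - a i)) ^+ k *
  \prod_i cauchy_bump (pairing X (A i) - a i)); first exact: transferable_prod_cauchy_bump.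
by apply/funext => X; rewrite exprSr.
Qed.

End transfer.

End cosine_moments.

(** * Concentration at the observation *)

Section concentration.
Variables (R : realType) (n : nat).
Implicit Types y u : 'cV[R]_n.

Definition peak y u := \prod_i cauchy_bump (u i 0 - y i 0).

Lemma peak_gt0 y u : 0 < peak y u.
Proof. by apply: prodr_gt0 => i _; exact: cauchy_bump_gt0. Qed.

Lemma peak_le y u : peak y u <= 2 ^+ n.
Proof.
rewrite -[n in 2 ^+ n]card_ord -prodr_const; apply: ler_prod => i _.
by rewrite cauchy_bump_le2 ltW// cauchy_bump_gt0.
Qed.

Lemma peak_center y : peak y y = 2 ^+ n.
Proof.
rewrite -[n in 2 ^+ n]card_ord -prodr_const; apply: eq_bigr => i _.
by rewrite subrr cauchy_bump0.
Qed.

(** Coordinate [i] alone loses the factor [cauchy_bump e / 2], which is less than 1; each other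
    factor is at most 2. *)
Lemma peak_far y u (e : R) i : 0 < e -> e <= `|u i 0 - y i 0| ->
  peak y u <= 2 ^+ n * (cauchy_bump e / 2).
Proof.
move=> e0 ei; rewrite -[n in 2 ^+ n]card_ord -prodr_const /peak.
rewrite (bigD1 i)//= [in leRHS](bigD1 i)//= mulrAC [2 * _]mulrC divfK ?pnatr_eq0//.
apply: ler_pM; rewrite ?(ltW (cauchy_bump_gt0 _))//.
- by apply: prodr_ge0 => j _; rewrite ltW// cauchy_bump_gt0.
- exact: cauchy_bump_le (ltW e0) ei.
- by apply: ler_prod => j _; rewrite cauchy_bump_le2 ltW// cauchy_bump_gt0.
Qed.

Lemma continuous_peak y : continuous (peak y).
Proof.
apply: continuous_big => [|i _ u]; first exact: mul_continuous.
apply: (@continuous_comp _ _ _ (fun v : 'cV[R]_n => v i 0 - y i 0) (@cauchy_bump R));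
  last exact: continuous_cauchy_bump.
exact: (cvgB (@coord_continuous R n 1 i 0 u) (cvg_cst (y i 0))).
Qed.

Lemma measurable_peak y : measurable_fun setT (peak y).
Proof. by apply: continuous_matrix_measurable; exact: continuous_peak. Qed.

Lemma open_peak_gt y r : open [set u | r < peak y u].
Proof.
rewrite (_ : [set _ | _] = peak y @^-1` `]r, +oo[%classic); last first.
  by apply/seteqP; split => u /=; rewrite in_itv/= andbT.
by apply: open_comp => [u _|]; [exact: continuous_peak|exact: rray_open].
Qed.

Section one_measure.
Context d (T : measurableType d) (P : probability T R) (Z : T -> 'cV[R]_n) (y : 'cV[R]_n).
Hypothesis mZ : measurable_fun setT Z.

Lemma peak_exp_integrable (f : 'cV[R]_n -> R) K k : measurable_fun setT f ->
  (forall u, `|f u| <= K) ->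
  P.-integrable setT (EFin \o (fun w => f (Z w) * peak y (Z w) ^+ k)).
Proof.
move=> mf fK; apply: (@bounded_integrable _ _ _ _ _ (K * (2 ^+ n) ^+ k)).
  apply: measurable_funM; first exact: measurableT_comp.
  by apply: measurable_funX; apply: measurableT_comp => //; exact: measurable_peak.
move=> w; rewrite normrM ler_pM// ger0_norm ?exprn_ge0 ?(ltW (peak_gt0 _ _))//.
by rewrite lerXn2r ?nnegrE ?peak_le// ltW ?peak_gt0.
Qed.

Lemma peak_exp_integrable1 k :
  P.-integrable setT (EFin \o (fun w => peak y (Z w) ^+ k)).
Proof.
rewrite (_ : (fun _ => _) = (fun w => cst 1 (Z w) * peak y (Z w) ^+ k)).
  by apply: (@peak_exp_integrable _ 1) => // u; rewrite normr1.
by apply/funext => w; rewrite mul1r.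
Qed.

Lemma measurable_peak_gt r : measurable (Z @^-1` [set u | r < peak y u]).
Proof.
by have := mZ measurableT (matrix_open_measurable (@open_peak_gt y r)); rewrite setTI.
Qed.

(** Markov's inequality for the weight. *)
Lemma peak_exp_mass r k : 0 <= r ->
  r ^+ k * fine (P (Z @^-1` [set u | r < peak y u])) <=
  \int[P]_w (peak y (Z w) ^+ k).
Proof.
move=> r0; set A := _ @^-1` _.
have mA : measurable A by exact: measurable_peak_gt.
have iA : P.-integrable setT (EFin \o (\1_A : T -> R)).
  apply: (@bounded_integrable _ _ _ _ _ 1) => // w.
  by rewrite indicE; case: (_ \in _); rewrite ?normr1 ?normr0.
have -> : fine (P A) = \int[P]_w (\1_A w : R).
  by rewrite /Rintegral integral_indic// setIT.
rewrite -RintegralZl//; apply: le_Rintegral => //.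
- exact: (integrableZl measurableT (r ^+ k) iA).
- exact: peak_exp_integrable1.
- move=> w _; rewrite indicE; have [|_] := boolP (w \in A).
    by rewrite inE mulr1 => /ltW ?; rewrite lerXn2r ?nnegrE// ltW ?peak_gt0.
  by rewrite mulr0 exprn_ge0// ltW ?peak_gt0.
Qed.

(** Where [f] is close to [f y], the error is at most [e] times the weight; elsewhere the weight is
    at most [rho ^+ k] and the oscillation of [f] at most [2 * K]. *)
Lemma peak_exp_approx (f : 'cV[R]_n -> R) (K e rho : R) k : measurable_fun setT f ->
  (forall u, `|f u| <= K) -> 0 <= e -> 0 <= rho ->
  (forall u, `|f u - f y| <= e \/ peak y u <= rho) ->
  `|\int[P]_w (f (Z w) * peak y (Z w) ^+ k) -
    f y * \int[P]_w (peak y (Z w) ^+ k)| <=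
  e * \int[P]_w (peak y (Z w) ^+ k) + 2 * K * rho ^+ k.
Proof.
move=> mf fK e0 rho0 near_far; have i1 := peak_exp_integrable1 k.
have iF := peak_exp_integrable k mf fK.
have K0 : 0 <= K by exact: le_trans (fK y).
have iZ c : P.-integrable setT (EFin \o (fun w => c * peak y (Z w) ^+ k)).
  exact: (integrableZl measurableT c i1).
have icst : P.-integrable setT (EFin \o (fun _ : T => 2 * K * rho ^+ k)).
  by apply: (@bounded_integrable _ _ _ _ _ `|2 * K * rho ^+ k|).
rewrite -!RintegralZl// -RintegralB//.
have -> : 2 * K * rho ^+ k = \int[P]_w (2 * K * rho ^+ k).
  by rewrite Rintegral_cst// [X in fine X]probability_setT mulr1.
rewrite -RintegralD//; apply: (le_trans (le_normr_Rintegral measurableT _)).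
  exact: (integrableB measurableT iF (iZ (f y))).
apply: le_Rintegral => //.
- exact/integrable_norm/(integrableB measurableT iF (iZ (f y))).
- exact: (integrableD measurableT (iZ e) icst).
- move=> w _; rewrite -mulrBl normrM.
  have p0 : 0 <= peak y (Z w) by rewrite ltW ?peak_gt0.
  rewrite (ger0_norm (exprn_ge0 _ p0)).
  have [ne|ne] := near_far (Z w).
    rewrite ler_wpDr ?ler_wpM2r ?exprn_ge0//.
    by rewrite mulr_ge0 ?exprn_ge0// mulr_ge0.
  rewrite ler_wpDl// ?mulr_ge0 ?exprn_ge0// ler_pM ?exprn_ge0//.
    by rewrite (le_trans (ler_normB _ _))// mulr_natl mulr2n lerD.
  by rewrite lerXn2r ?nnegrE.
Qed.

End one_measure.

(** Outside the ball given by the continuity of [f] at [y], some coordinate is off by at least the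
    radius, and [peak_far] applies. *)
Lemma peak_near_far (f : 'cV[R]_n -> R) y (e : R) : continuous f -> 0 < e ->
  exists2 rho, 0 <= rho < 2 ^+ n &
    forall u, `|f u - f y| <= e \/ peak y u <= rho.
Proof.
move=> cf e0.
have /nbhs_ballP[dl /= dl0 fdl] : \forall u \near y, `|f y - f u| < e.
  by move/cvgrPdist_lt: (cf y) => /(_ _ e0).
exists (2 ^+ n * (cauchy_bump dl / 2)).
  rewrite mulr_ge0 ?exprn_ge0 ?divr_ge0 ?(ltW (cauchy_bump_gt0 _))//=.
  by rewrite -[ltRHS]mulr1 ltr_pM2l ?exprn_gt0// ltr_pdivrMr// mul1r cauchy_bump_lt2.
move=> u; have [|] := pselect (ball y dl u); first by move=> /fdl/ltW; left; rewrite distrC.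
move=> far; right; have [i dli] : exists i, dl <= `|u i 0 - y i 0|.
  apply: contrapT => /forallNP H; apply: far; split => // i j; rewrite (ord1 j).
  by rewrite /ball/= distrC ltNge; exact/negP/H.
exact: peak_far dli.
Qed.

(* As [k] grows, the weights [peak y ^+ k] concentrate at [y], so that their
   moments determine the value at [y] of a continuous function. *)
Lemma peak_moments_inj d1 (T1 : measurableType d1) (P1 : probability T1 R)
    (Z1 : T1 -> 'cV[R]_n) d2 (T2 : measurableType d2) (P2 : probability T2 R)
    (Z2 : T2 -> 'cV[R]_n) (f1 f2 : 'cV[R]_n -> R) (K : R) (y : 'cV[R]_n) :
  measurable_fun setT Z1 -> measurable_fun setT Z2 ->
  continuous f1 -> continuous f2 ->
  (forall u, `|f1 u| <= K) -> (forall u, `|f2 u| <= K) ->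
  (forall k, \int[P1]_w (peak y (Z1 w) ^+ k) = \int[P2]_w (peak y (Z2 w) ^+ k)) ->
  (forall k, \int[P1]_w (f1 (Z1 w) * peak y (Z1 w) ^+ k) =
    \int[P2]_w (f2 (Z2 w) * peak y (Z2 w) ^+ k)) ->
  (forall U, open U -> U y -> (0 < P2 (Z2 @^-1` U))%E) ->
  f1 y = f2 y.
Proof.
move=> mZ1 mZ2 cf1 cf2 f1K f2K eqc eqf supp.
apply: contrapT => /eqP; rewrite -subr_eq0 -normr_gt0.
set eta := `|_| => eta0.
have e0 : 0 < eta / 4 by rewrite divr_gt0.
have K0 : 0 <= K by exact: le_trans (f1K y).
have [r1 /andP[r10 r1n] nf1] := peak_near_far y cf1 e0.
have [r2 /andP[r20 r2n] nf2] := peak_near_far y cf2 e0.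
pose rho := Num.max r1 r2.
have rho0 : 0 <= rho by rewrite le_max r10.
have rhon : rho < 2 ^+ n by rewrite gt_max r1n.
have {}nf1 u : `|f1 u - f1 y| <= eta / 4 \/ peak y u <= rho.
  by have [|pu] := nf1 u; [left|right; rewrite le_max pu].
have {}nf2 u : `|f2 u - f2 y| <= eta / 4 \/ peak y u <= rho.
  by have [|pu] := nf2 u; [left|right; rewrite le_max pu orbT].
(* Any level strictly between [rho] and the maximum of the peak serves: the set above it is an open
   neighbourhood of [y], of positive mass [p], and [rho / r] is less than 1. *)
pose r := (rho + 2 ^+ n) / 2.
have [rhor rn] : rho < r /\ r < 2 ^+ n by rewrite /r; split; lra.
have r0 : 0 < r by exact: le_lt_trans rhor.
pose p := fine (P2 (Z2 @^-1` [set u | r < peak y u])).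
have p0 : 0 < p.
  rewrite fine_gt0// supp/=; last 2 first.
  - exact: open_peak_gt.
  - by rewrite /= peak_center.
  rewrite (le_lt_trans (probability_le1 _ _)) ?ltry//.
  exact: measurable_peak_gt.
have mf1 : measurable_fun setT f1 by exact: continuous_matrix_measurable.
have mf2 : measurable_fun setT f2 by exact: continuous_matrix_measurable.
(* Each approximation costs [eta / 4] times the common total weight, so half of [eta] survives; that
   weight is at least [r ^+ k * p]. *)
have bound k : eta / 2 * p * r ^+ k <= 4 * K * rho ^+ k.
  have A1 := peak_exp_approx P1 mZ1 k mf1 f1K (ltW e0) rho0 nf1.
  have A2 := peak_exp_approx P2 mZ2 k mf2 f2K (ltW e0) rho0 nf2.
  move: A1 A2 (peak_exp_mass P2 y mZ2 k (ltW r0)); rewrite eqc eqf -/p.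
  set c := \int[P2]_w (peak _ _ ^+ _); set m := Rintegral _ _ _ => A1 A2 rc.
  have : eta * c <= eta / 4 * c + 2 * K * rho ^+ k + (eta / 4 * c + 2 * K * rho ^+ k).
    have c0 : 0 <= c by rewrite (le_trans _ rc)// mulr_ge0 ?exprn_ge0 ?(ltW r0)// (ltW p0).
    rewrite -[in leLHS](ger0_norm c0) -normrM mulrBl.
    rewrite (_ : _ - _ = (m - f2 y * c) - (m - f1 y * c)); last by ring.
    by rewrite (le_trans (ler_normB _ _))// addrC lerD.
  have : eta / 2 * (r ^+ k * p) <= eta / 2 * c by rewrite ler_wpM2l// ltW ?divr_gt0.
  rewrite (_ : eta / 2 * p * r ^+ k = eta / 2 * (r ^+ k * p)); last by ring.
  move: (rho ^+ k) (eta / 2 * (r ^+ k * p)) => a z; lra.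
have rr1 : `|rho / r| < 1 
  by rewrite (ger0_norm (divr_ge0 rho0 (ltW r0))) (ltr_pdivrMr _ _ r0) mul1r.
(* Divide by [r ^+ k] and let [k] tend to infinity. *)
have L : eta / 2 * p <= 4 * K * 0.
  have C : 4 * K * (rho / r) ^+ k @[k --> \oo] --> 4 * K * 0.
    by apply: cvgM; [exact: cvg_cst|exact: cvg_expr].
  apply: (cvgr_to_ge C); apply: nearW => k.
  rewrite expr_div_n [leRHS]mulrA (ler_pdivlMr _ _ (exprn_gt0 k r0)).
  exact: bound.
by move: L; rewrite mulr0 leNgt mulr_gt0// divr_gt0.
Qed.

End concentration.

(** * Uniqueness of the posterior mean *)

Section kernel_law.
Context (R : realType) d1 d2 (T1 : measurableType d1) (T2 : measurableType d2).
Variables (k : R.-pker T1 ~> T2) (u : T1).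

(** A name for [k u] that carries the structure of a probability measure. *)
Definition kernel_law : set T2 -> \bar R := k u.

HB.instance Definition _ := Measure.on kernel_law.

Let kernel_law_setT : kernel_law setT = 1%E. Proof. exact: prob_kernel. Qed.

HB.instance Definition _ :=
  Measure_isProbability.Build _ _ R kernel_law kernel_law_setT.

End kernel_law.

Section posterior_mean_unique.
Variables (R : realType) (N : nat).
Local Notation pairing X A := (\tr (X^T *m A)).

Lemma pairing_delta (X : 'M[R]_N) i j : pairing X (delta_mx i j) = X i j.
Proof.
rewrite /mxtrace (bigD1 j)//= big1 ?addr0 => [|k kj].
  rewrite mxE (bigD1 i)//= big1 ?addr0 => [|l li]; rewrite !mxE ?eqxx ?mulr1//.
  by rewrite (negbTE li) mulr0.
by rewrite mxE big1// => l _; rewrite !mxE (negbTE kj) andbF mulr0.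
Qed.

(** The coordinates of the observation are thus linear functionals of the matrix, so that bumps in
    them fit [transferable_exp]. *)
Lemma pairing_mulmx (X : 'M[R]_N) (s : 'cV[R]_N) i :
  pairing X (delta_mx i 0 *m s^T) = (X *m s) i 0.
Proof.
rewrite mulmxA mxtrace_mulC mulmxA -[X in X *m _]trmxK trmx_mul trmxK.
rewrite -(trmxK (delta_mx i 0)) -trmx_mul mxtrace_tr trmx_delta -rowE.
by rewrite trmxK trace_mx11 mxE.
Qed.

(** The phase [- pi / 2] turns the cosine into [sin (t * X i j)], whose derivative at 0 is [X i j];
    differentiation under the integral is dominated by [|X i j|]. The constant 1 disappears in the
    derivative and keeps the integrand nonnegative. *)
Lemma mean_cos_moments (nu : probability 'M[R]_N R) (M : 'M[R]_N) i j :
  is_mean nu M ->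
  M i j = derive1 (fun t : R =>
    \int[nu]_X (1 + cos (pairing X (t *: delta_mx i j) - pi / 2))) 0.
Proof.
move=> /(_ i j) [intX ->].
have E (t : R) X : cos (pairing X (t *: delta_mx i j) - pi / 2) = sin (t * X i j).
  by rewrite -scalemxAr mxtraceZ pairing_delta cosBpihalf.
have dsin (x t : R) : is_derive t 1 (fun z : R => 1 + sin (z * x)) (cos (t * x) * x).
  have D := is_deriveD (is_derive_cst (1 : R) t 1)
    (@is_derive1_comp R sin (fun z => z * x) t _ _ (is_derive_sin _) (is_derive_mulr x t)).
  by apply: is_derive_eq D _; rewrite add0r.
have mX : measurable_fun setT (fun X : 'M[R]_N => X i j) by exact: measurable_matrix_entry.
have msin t : measurable_fun setT (fun X : 'M[R]_N => 1 + sin (t * X i j)).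
  apply: measurable_funD => //.
  apply: (measurableT_comp (continuous_measurable_fun (@continuous_sin R))).
  exact: measurable_funM.
have U0 : `]-1, 1[%classic (0 : R) by rewrite /= in_itv/= ltrN10 ltr01.
pose f (t : R) (X : 'M[R]_N) := 1 + sin (t * X i j).
have p1 t X : partial1of2 f t X = cos (t * X i j) * X i j.
  by rewrite partial1of2E; have [_ ->] := dsin (X i j) t.
rewrite (_ : (fun _ => _) = fun t => \int[nu]_X f t X); last first.
  by apply/funext => t; apply: eq_Rintegral => X _; rewrite E.
have -> := @differentiation_under_integral R _ _ nu f setT measurableT 0 (-1) 1 U0
  _ _ (fun X => `|X i j|) _ _ _.
- by apply: eq_Rintegral => X _; rewrite p1 mul0r cos0 mul1r.
- move=> t _; apply: (@bounded_integrable _ _ _ _ _ 2); first exact: msin.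
  move=> X; rewrite /f.
  by rewrite (le_trans (ler_normD _ _))// normr1 lerD2l sin_max.
- by move=> t X _ _; have [] := dsin (X i j) t.
- by [].
- exact: integrable_norm.
- by move=> t X _ _; rewrite p1 normrM ler_piMl// norm_cos_le1.
Qed.

Lemma normr_Rintegral_prob_le d (T : measurableType d) (P : probability T R)
    (f : T -> R) K : measurable_fun setT f -> (forall x, `|f x| <= K) ->
  `|\int[P]_x f x| <= K.
Proof.
move=> mf fK; have intf := bounded_integrable P mf fK.
rewrite (le_trans (le_normr_Rintegral measurableT intf))//.
have -> : K = \int[P]_x (cst K x).
  by rewrite Rintegral_cst// [X in fine X]probability_setT mulr1.
apply: le_Rintegral => //; first exact: integrable_norm.
by apply: (@bounded_integrable _ _ _ _ _ `|K|).
Qed.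

(** The weight depends on the observation alone, so it factors out of the inner integral of the
    disintegration. *)
Lemma cond_expectation_peak d (T : measurableType d) (P : probability T R)
    (B : T -> 'M[R]_N) (s y : 'cV[R]_N) (k : R.-pker 'cV[R]_N ~> 'M[R]_N)
    (g : 'M[R]_N -> R) (K : R) n : measurable_fun setT B ->
  cond_distribution P B (fun w => B w *m s) k ->
  measurable_fun setT g -> (forall X, 0 <= g X <= K) ->
  (\int[P]_w ((\int[k (B w *m s)]_X g X) * peak y (B w *m s) ^+ n)%:E =
   \int[P]_w (g (B w) * peak y (B w *m s) ^+ n)%:E)%E.
Proof.
move=> mB cd mg gK.
have mZ : measurable_fun setT (fun w => B w *m s).
  by apply: measurable_mulmx => //; exact: measurable_cst.
pose F (p : 'cV[R]_N * 'M[R]_N) : \bar R := (g p.2 * peak y p.1 ^+ n)%:E.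
have mF : measurable_fun setT F.
  apply/measurable_EFinP; apply: measurable_funM; first exact: measurableT_comp.
  by apply: measurable_funX; apply: measurableT_comp => //; exact: measurable_peak.
have F0 p : (0 <= F p)%E.
  by rewrite lee_fin mulr_ge0 ?exprn_ge0 ?(ltW (peak_gt0 _ _))//; case/andP: (gK p.2).
rewrite -[RHS]/(\int[P]_w F (B w *m s, B w))%E.
rewrite (ge0_integral_cond_distribution mZ mB cd mF F0).
apply: eq_integral => w _; rewrite /F/=.
have ig : (k (B w *m s)).-integrable setT (EFin \o g).
  apply: (@bounded_integrable _ _ _ (kernel_law k (B w *m s)) _ K) => // X.
  by have /andP[g0 ?] := gK X; rewrite ger0_norm.
under eq_integral do rewrite EFinM.
rewrite integralZr//= EFinM; congr (_ * _)%E.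
by rewrite fineK//; exact: integrable_fin_num.
Qed.

Section uniqueness.
Context d1 (T1 : measurableType d1) (P1 : probability T1 R) (B1 : T1 -> 'M[R]_N).
Context d2 (T2 : measurableType d2) (P2 : probability T2 R) (B2 : T2 -> 'M[R]_N).
Variables (s y : 'cV[R]_N) (k1 k2 : R.-pker 'cV[R]_N ~> 'M[R]_N).
Hypotheses (mB1 : measurable_fun setT B1) (mB2 : measurable_fun setT B2).
Hypothesis same_law : forall A (D : set R), measurable D ->
  P1 ((fun w => pairing (B1 w) A) @^-1` D) =
  P2 ((fun w => pairing (B2 w) A) @^-1` D).
Hypotheses (cd1 : cond_distribution P1 B1 (fun w => B1 w *m s) k1)
  (cd2 : cond_distribution P2 B2 (fun w => B2 w *m s) k2).
Hypotheses (wc1 : weakly_continuous k1) (wc2 : weakly_continuous k2).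
Hypothesis supp : forall U, open U -> U y ->
  (0 < P2 ((fun w => B2 w *m s) @^-1` U))%E.

(** Apply [peak_moments_inj] to the two conditional expectations of [g], which are continuous in the
    observation by weak continuity. By disintegration their peak moments become cosine moments of
    the two matrices, which agree by transfer. *)
Lemma posterior_cos_moments A th :
  \int[k1 y]_X (1 + cos (pairing X A + th)) =
  \int[k2 y]_X (1 + cos (pairing X A + th)).
Proof.
pose g (X : 'M[R]_N) := 1 + cos (pairing X A + th).
have g02 X : 0 <= g X <= 2.
  by rewrite /g -lerBlDl sub0r cos_geN1 -lerBrDl (_ : 2 - 1 = 1) ?cos_le1//; ring.
have gN2 X : `|g X| <= 2 by have /andP[? ?] := g02 X; rewrite ger0_norm.
have cg : continuous g.
  have cl : continuous (fun X : 'M[R]_N => pairing X A + th).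
    by move=> X; exact: (cvgD (@continuous_pairing R N A X) (cvg_cst th)).
  have cc : continuous (fun X : 'M[R]_N => cos (pairing X A + th)).
    by move=> X; exact: (continuous_comp (cl X) (@continuous_cos R _)).
  have cD (c : R) : continuous (fun X : 'M[R]_N => c + cos (pairing X A + th)).
    by move=> X; exact: (cvgD (cvg_cst c) (cc X)).
  exact: (cD 1).
have mg : measurable_fun setT g by exact: continuous_matrix_measurable.
have peakE n X : peak y (X *m s) ^+ n =
    (\prod_i cauchy_bump (pairing X (delta_mx i 0 *m s^T) - y i 0)) ^+ n.
  by congr (_ ^+ _); apply: eq_bigr => i _; rewrite pairing_mulmx.
have mZ d (T : measurableType d) (B : T -> 'M[R]_N) : measurable_fun setT B ->
    measurable_fun setT (fun w => B w *m s).
  by move=> mB; apply: measurable_mulmx => //; exact: measurable_cst.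
have tr n := transferable_exp mB1 mB2 same_law n (fun i => delta_mx i 0 *m s^T)
  (fun i => y i 0).
have momentE d (T : measurableType d) (P : probability T R) B n A1 th1 :
    (\int[P]_w (cos (pairing (B w) A1 + th1) * peak y (B w *m s) ^+ n)%:E)%E =
    cos_moment P B (fun X => (\prod_i cauchy_bump (pairing X (delta_mx i 0 *m s^T) - y i 0)) ^+ n) A1 th1.
  by apply: eq_integral => w _; rewrite peakE mulrC.
have eq_moment n A1 th1 :
    (\int[P1]_w (cos (pairing (B1 w) A1 + th1) * peak y (B1 w *m s) ^+ n)%:E =
     \int[P2]_w (cos (pairing (B2 w) A1 + th1) * peak y (B2 w *m s) ^+ n)%:E)%E.
  by rewrite !momentE; have [_ _ ->] := tr n.
(* The constant 1 is itself a cosine, so total weights are cosine moments too. *)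
have oneE (X : 'M[R]_N) : 1 = cos (pairing X 0 + 0) by rewrite mulmx0 mxtrace0 addr0 cos0.
pose G n X := (\prod_i cauchy_bump (pairing X (delta_mx i 0 *m s^T) - y i 0)) ^+ n : R.
have sumE d (T : measurableType d) (P : probability T R) B n K : measurable_fun setT B ->
    measurable_fun setT (G n) -> (forall X, `|G n X| <= K) ->
    (\int[P]_w (g (B w) * peak y (B w *m s) ^+ n)%:E =
     cos_moment P B (G n) 0 0 + cos_moment P B (G n) A th)%E.
  move=> mB mG GK; rewrite -(integralD measurableT
    (cos_moment_integrable P 0 0 mB mG GK) (cos_moment_integrable P A th mB mG GK)).
  apply: eq_integral => w _; rewrite -EFinD -oneE peakE -/(G n (B w)); congr EFin.
  by rewrite /g mulrDl mul1r mulr1 mulrC.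
apply: (@peak_moments_inj R N _ _ P1 (fun w => B1 w *m s) _ _ P2 (fun w => B2 w *m s)
  (fun u => \int[k1 u]_X g X) (fun u => \int[k2 u]_X g X) 2 y).
- exact: mZ.
- exact: mZ.
- by apply: wc1 => //; exists 2.
- by apply: wc2 => //; exists 2.
- by move=> u; apply: (normr_Rintegral_prob_le (kernel_law k1 u)).
- by move=> u; apply: (normr_Rintegral_prob_le (kernel_law k2 u)).
- move=> n; congr fine.
  under eq_integral => w _ do rewrite -[X in X%:E]mul1r {1}(oneE (B1 w)).
  under [RHS]eq_integral => w _ do rewrite -[X in X%:E]mul1r {1}(oneE (B2 w)).
  exact: eq_moment.
- move=> n; congr fine.
  rewrite (cond_expectation_peak _ _ mB1 cd1 mg g02) (cond_expectation_peak _ _ mB2 cd2 mg g02).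
  have [mG [K GK] eG] := tr n.
  by rewrite (sumE _ _ P1 _ _ K)// (sumE _ _ P2 _ _ K)// !eG.
- exact: supp.
Qed.

Lemma posterior_mean_unique (nu1 nu2 : probability 'M[R]_N R) (M1 M2 : 'M[R]_N) :
  nu1 = k1 y :> (set _ -> _) -> nu2 = k2 y :> (set _ -> _) ->
  is_mean nu1 M1 -> is_mean nu2 M2 -> M1 = M2.
Proof.
move=> nu1E nu2E m1 m2; apply/matrixP => i j.
rewrite (mean_cos_moments i j m1) (mean_cos_moments i j m2).
have eqI (nu : probability 'M[R]_N R) (k : R.-pker 'cV[R]_N ~> 'M[R]_N) (f : 'M[R]_N -> R) :
    nu = k y :> (set _ -> _) -> \int[nu]_X f X = \int[k y]_X f X.
  move=> nuE; congr fine; apply: eq_measure_integral => D _ _.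
  exact: (congr1 (fun m => m D) nuE).
have -> : (fun t : R => \int[nu1]_X (1 + cos (pairing X (t *: delta_mx i j) - pi / 2))) =
    (fun t : R => \int[nu2]_X (1 + cos (pairing X (t *: delta_mx i j) - pi / 2))).
  apply/funext => t; rewrite (eqI nu1 k1)// (eqI nu2 k2)//.
  exact: posterior_cos_moments.
by [].
Qed.

End uniqueness.

End posterior_mean_unique.

(** * Existence of the posterior *)

Section noise_kernel.
Context (R : realType) dU (U : measurableType dU) dV (V : measurableType dV).
Context d (T : measurableType d) (P : probability T R).
Variable H : U -> T -> V.
Hypothesis mH : measurable_fun setT (fun z : U * T => H z.1 z.2).

Let measurable_noise u : measurable_fun setT (H u).
Proof. exact: (measurableT_comp mH (pair1_measurable u)). Qed.

Definition noise_kernel (u : U) : {measure set V -> \bar R} :=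
  image_measure P (measurable_noise u).

Let measurable_noise_kernel A : measurable A ->
  measurable_fun setT (noise_kernel ^~ A).
Proof.
move=> mA; pose E : set (U * T) := (fun z => H z.1 z.2) @^-1` A.
have mE : measurable E by rewrite -[E]setTI; exact: mH.
rewrite (_ : (fun _ => _) = (fun u => P (xsection E u))).
  exact: measurable_fun_xsection.
apply/funext => u; rewrite /noise_kernel /= /pushforward; congr (P _).
by apply/seteqP; split => x; rewrite /xsection /= inE.
Qed.

HB.instance Definition _ := isKernel.Build _ _ _ _ R noise_kernel
  measurable_noise_kernel.

Let noise_kernel_prob u : noise_kernel u setT = 1%E.
Proof. by rewrite /noise_kernel /= /pushforward preimage_setT probability_setT. Qed.

HB.instance Definition _ := Kernel_isProbability.Build _ _ _ _ R noise_kernel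
  noise_kernel_prob.

(** In the product space the second coordinate is independent of [Y]; conditioning therefore amounts
    to freezing the first argument of [H]. *)
Lemma cond_distribution_noise d1 (T1 : measurableType d1)
    (P1 : probability T1 R) (Y : T1 -> U) : measurable_fun setT Y ->
  cond_distribution (P1 \x P)%E (fun p => H (Y p.1) p.2) (fun p => Y p.1)
    noise_kernel.
Proof.
move=> mY A C mA mC.
pose G : T1 -> \bar R := (fun x => noise_kernel (Y x) A) \_ (Y @^-1` C).
have mC1 : measurable (Y @^-1` C) by rewrite -[X in measurable X]setTI; exact: mY.
have mG : measurable_fun setT G.
  apply/(measurable_restrictT _ mC1); apply: measurable_funTS.
  exact: (measurableT_comp (measurable_noise_kernel mA) mY).
transitivity (\int[P1]_x G x)%E.
  rewrite /= /product_measure1 /=; apply: eq_integral => x _.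
  rewrite /G patchE; case: ifPn; rewrite ?inE ?notin_setE /= => Cx.
    rewrite /noise_kernel /= /pushforward; congr (P _).
    by apply/seteqP; split => w; rewrite /xsection /= inE /= => // -[].
  rewrite (_ : xsection _ _ = set0) ?measure0//.
  by apply/seteqP; split => // w; rewrite /xsection /= inE /= => -[_ /Cx].
rewrite [RHS]integral_mkcond.
transitivity (\int[(P1 \x P)%E]_p G p.1)%E; last first.
  by apply: eq_integral => p _; rewrite /G !patchE.
rewrite (fubini_tonelli1 (fun p => G p.1))/=.
- by apply: eq_integral => x _; rewrite /fubini_F -[RHS]/(\int[P]_w (cst (G x) w))%E
    (integral_cst P measurableT) [X in (_ * X)%E]probability_setT mule1.
- exact: measurableT_comp.
- by move=> p; rewrite /G patchE; case: ifPn.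
Qed.

End noise_kernel.

Section sequential_continuity.
Variables (R : realType) (U : pseudoMetricType R).

(** If continuity fails at [u], points chosen in balls of radius [1 / (n + 1)] form a bad sequence.
    This reduces weak continuity to dominated convergence, which concerns sequences. *)
Lemma sequentially_continuous (f : U -> R) :
  (forall (u : U) (v : nat -> U), v n @[n --> \oo] --> u ->
    f (v n) @[n --> \oo] --> f u) -> continuous f.
Proof.
move=> sf u; apply/cvgrPdist_lt => e e0; apply: contrapT => nf.
have /choice[v vP] : forall n : nat, exists v, ball u (n.+1%:R^-1) v /\ e <= `|f u - f v|.
  move=> n; apply: contrapT => /forallNP H; apply: nf.
  apply/nbhs_ballP; exists n.+1%:R^-1; first by rewrite /= invr_gt0.
  by move=> v bv; rewrite ltNge; apply/negP => ef; exact: (H v).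
have /cvgrPdist_lt/(_ _ e0)[n _ /(_ n (leqnn n))] : f (v n) @[n --> \oo] --> f u.
  apply: sf; apply/cvg_ballP => r r0.
  near=> n; apply: le_ball (vP n).1; apply: ltW.
  by near: n; exact: near_infty_natSinv_lt (PosNum r0).
by rewrite /= ltNge (vP n).2.
Unshelve. all: by end_near. Qed.

End sequential_continuity.

Section noise_kernel_continuity.
Variables (R : realType) (m n p q : nat).
Context d (T : measurableType d) (P : probability T R).
Variable H : 'M[R]_(p, q) -> T -> 'M[R]_(m, n).
Hypothesis mH : measurable_fun setT (fun z : 'M[R]_(p, q) * T => H z.1 z.2).

Lemma Rintegral_noise_kernel (f : 'M[R]_(m, n) -> R) u :
  measurable_fun setT f -> P.-integrable setT (EFin \o (fun w => f (H u w))) ->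
  \int[noise_kernel P mH u]_x f x = \int[P]_w f (H u w).
Proof.
move=> mf intf; congr fine; rewrite /noise_kernel integral_pushforward//.
- exact: (measurableT_comp mH (pair1_measurable u)).
- exact/measurable_EFinP.
Qed.

Lemma noise_kernel_weakly_continuous :
  (forall w, continuous (H ^~ w)) -> weakly_continuous (noise_kernel P mH).
Proof.
move=> cH f cf [K fK].
have mf : measurable_fun setT f by exact: continuous_matrix_measurable.
have mfH u : measurable_fun setT (fun w => f (H u w)).
  exact: (measurableT_comp mf (measurableT_comp mH (pair1_measurable u))).
have intf u : P.-integrable setT (EFin \o (fun w => f (H u w))).
  by apply: (@bounded_integrable _ _ _ _ _ K).
apply: sequentially_continuous => u v vu.
rewrite (Rintegral_noise_kernel mf (intf u)).
under eq_fun do rewrite (Rintegral_noise_kernel mf (intf _)).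
have fin z : (\int[P]_w (f (H z w))%:E)%E \is a fin_num.
  exact: (integrable_fin_num measurableT (intf z)).
suff C : (\int[P]_w (f (H (v k) w))%:E)%E @[k --> \oo] --> (\int[P]_w f (H u w))%:E.
  exact: (fine_cvg C).
rewrite /Rintegral fineK//.
apply: (@dominated_cvg _ _ _ _ _ measurableT _ _ (cst K%:E)).
- by move=> k; exact/measurable_EFinP.
- move=> w _; apply: cvg_EFin; first exact: nearW.
  apply: (cvg_comp (fun k => H (v k) w) f); last exact: cf.
  by apply: (cvg_comp v (H ^~ w)); [exact: vu|exact: cH].
- by [].
- by apply: (@bounded_integrable _ _ _ _ (cst K) `|K|).
- by move=> k w _; rewrite lee_fin.
Qed.

End noise_kernel_continuity.

(** * The projection attached to an update *)

Section secant_projection.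
Variables (R : realType) (N : nat).
Implicit Types (W X : 'M[R]_N) (s c : 'cV[R]_N).

(** When [dot c s != 0], the projection whose kernel is spanned by [c] and whose image is the
    orthogonal complement of [s]. *)
Definition secant_proj s c : 'M[R]_N := 1%:M - (dot c s)^-1 *: (c *m s^T).

Lemma tr_secant_proj s c :
  (secant_proj s c)^T = 1%:M - (dot c s)^-1 *: (s *m c^T).
Proof. by rewrite /secant_proj trmxD trmxN trmxZ tr_outer trmx1. Qed.

Lemma tr_secant_projK s c : dot c s != 0 -> (secant_proj s c)^T *m s = 0.
Proof.
move=> cs0; rewrite tr_secant_proj mulmxBl mul1mx -scalemxAl mulmx_tr_dot.
by rewrite scalerA mulVf// scale1r subrr.
Qed.

Lemma secant_projK s c : dot c s != 0 -> secant_proj s c *m c = 0.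
Proof.
move=> cs0; rewrite /secant_proj mulmxBl mul1mx -scalemxAl mulmx_tr_dot.
by rewrite scalerA (dotC s) mulVf// scale1r subrr.
Qed.

Lemma secant_proj_idem s c : dot c s != 0 ->
  secant_proj s c *m secant_proj s c = secant_proj s c.
Proof.
move=> cs0; rewrite {2}/secant_proj mulmxBr mulmx1 -scalemxAr mulmxA.
by rewrite secant_projK// mul0mx scaler0 subr0.
Qed.

(** Both sides equal [W] minus a multiple of [c *m c^T], where [c = W *m s]. *)
Lemma secant_proj_sym W s : W^T = W ->
  secant_proj s (W *m s) *m W = W *m (secant_proj s (W *m s))^T.
Proof.
move=> WT; rewrite tr_secant_proj /secant_proj mulmxBl mulmxBr mul1mx mulmx1.
by rewrite -scalemxAl -scalemxAr -!mulmxA trmx_mul WT.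
Qed.

Lemma dennis_update_projection (B0 X : 'M[R]_N) s c : X^T = X ->
  dennis_update B0 s ((B0 + X) *m s) c =
  B0 + (X - secant_proj s c *m X *m (secant_proj s c)^T).
Proof.
move=> XT; rewrite /dennis_update.
have -> : (B0 + X) *m s - B0 *m s = X *m s by rewrite mulmxDl addrAC subrr add0r.
rewrite tr_secant_proj.
rewrite /secant_proj; set a := (dot c s)^-1; rewrite -exprVn -/a -addrA; congr (_ + _).
rewrite trmx_mul XT; set U := c *m s^T; set V := s *m c^T.
have -> : X *m s *m c^T = X *m V by rewrite mulmxA.
have -> : c *m (s^T *m X) = U *m X by rewrite mulmxA.
have -> : U *m (X *m s) *m c^T = U *m X *m V by rewrite !mulmxA.
rewrite mulmxBl mul1mx -scalemxAl mulmxBr mulmx1 mulmxBl -!scalemxAl -!scalemxAr.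
rewrite scalerA -expr2 scalerDr !opprB.
by rewrite [in RHS](addrA (_ - _)) [RHS]addrC subrK addrAC.
Qed.

Lemma continuous_dennis_update (B0 : 'M[R]_N) s c :
  continuous (fun y => dennis_update B0 s y c).
Proof.
rewrite (_ : (fun _ => _) = (fun y : 'cV[R]_N => B0 +
    (dot c s)^-1 *: ((y - B0 *m s) *m c^T + c *m (y - B0 *m s)^T) +
    (- (dot c s ^+ 2)^-1) *: (c *m s^T *m (y - B0 *m s) *m c^T))); last first.
  by apply/funext => y; rewrite /dennis_update scaleNr.
have cst m n (M : 'M[R]_(m, n)) : continuous (fun _ : 'cV[R]_N => M).
  exact: cst_continuous.
have cr : continuous (fun y : 'cV[R]_N => y - B0 *m s).
  by apply: continuous_addmx => // y; exact: cvg_id.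
apply: continuous_addmx; first apply: continuous_addmx => //.
  apply: continuous_scalemx; apply: continuous_addmx; apply: continuous_mulmx => //.
  exact: continuous_trmx.
apply: continuous_scalemx; apply: continuous_mulmx; last exact: cst.
by apply: continuous_mulmx; [exact: cst|exact: cr].
Qed.

(** With [W = L *m L^T], the form is the squared Frobenius norm of [L^T *m symm A *m L]. *)
Lemma symkron_form_ge0 W (A : 'M[R]_N) : posdef W -> 0 <= symkron_form W A.
Proof.
move=> /posdef_cholesky[L WE]; rewrite /symkron_form WE.
set Q := L^T *m symm A *m L.
have QT : Q^T = Q by rewrite /Q !trmx_mul trmxK symm_tr mulmxA.
have -> : symm A *m (L *m L^T) *m symm A *m (L *m L^T) =
    (symm A *m L) *m (L^T *m symm A *m L *m L^T) by rewrite !mulmxA.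
rewrite mxtrace_mulC -!mulmxA !mulmxA.
rewrite (_ : _ *m L = Q^T *m Q); last by rewrite QT /Q !mulmxA.
rewrite /mxtrace sumr_ge0// => i _; rewrite mxE sumr_ge0// => j _.
by rewrite mxE -expr2 sqr_ge0.
Qed.

End secant_projection.

Section posterior_exists.
Variables (R : realType) (N : nat).
Variables (B0 Bt W : 'M[R]_N) (s : 'cV[R]_N).
Hypotheses (B0T : B0^T = B0) (BtT : Bt^T = Bt) (Wpos : posdef W) (s0 : s != 0).
Let y := Bt *m s.
Let c := W *m s.
Let P0 := secant_proj s c.
Local Notation pairing X A := (\tr (X^T *m A)).

Lemma dennis_posterior_exists :
  exists d (T : measurableType d) (P : probability T R)
    (B : {mfun T >-> 'M[R]_N}) (k : R.-pker 'cV[R]_N ~> 'M[R]_N),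
  [/\ [/\ forall w, (B w)^T = B w,
    gaussian_vector P (fun w => mxvec (B w)) (mxvec B0) (symkron W)
    & forall U, open U -> U y -> (0 < P ((fun w => B w *m s) @^-1` U))%E],
   cond_distribution P B (fun w => B w *m s) k, weakly_continuous k
   & is_mean (kernel_law k y) (dennis_update B0 s y c)].
Proof.
have cs0 : dot c s != 0 by rewrite gt_eqF// posdef_curvature.
have P0_idem : P0 *m P0 = P0 by exact: secant_proj_idem.
have P0_sym : P0 *m W = W *m P0^T by apply: secant_proj_sym; case: Wpos.
have [d [T [P [X [mX XT Xlaw Xsupp]]]]] := symmetric_gaussian_exists Wpos.
have mcst dS (S : measurableType dS) m n (M : 'M[R]_(m, n)) :
  measurable_fun setT (fun _ : S => M) by exact: measurable_cst.
pose Z w := P0 *m X w *m P0^T.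
have mZ : measurable_fun setT Z.
  by apply: measurable_mulmx; [apply: measurable_mulmx|]; [exact: mcst|exact: mX|exact: mcst].
have ZT w : (Z w)^T = Z w by rewrite /Z !trmx_mul trmxK XT mulmxA.
have Z_pairing A w : pairing (Z w) A = pairing (X w) (P0^T *m A *m P0).
  by rewrite /Z !trmx_mul trmxK -(mulmxA P0) mxtrace_mulC !mulmxA.
pose F u := dennis_update B0 s u c.
have cF : continuous F by exact: continuous_dennis_update.
have mF : measurable_fun setT F.
  apply: measurable_matrix => i j; apply: continuous_matrix_measurable.
  exact: continuous_matrix_entry.
pose Y w := (B0 + X w) *m s.
have mY : measurable_fun setT Y.
  apply: measurable_mulmx; last exact: mcst.
  by apply: measurable_addmx; [exact: mcst|exact: mX].
pose H u w := F u + Z w.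
have mH : measurable_fun setT (fun z : 'cV[R]_N * T => H z.1 z.2).
  by apply: measurable_addmx; exact: measurableT_comp.
(* The first copy of the Gaussian matrix determines the observation, the second supplies the
   independent residual noise. *)
pose B (p : T * T) := H (Y p.1) p.2.
have mB : measurable_fun setT B.
  apply: measurable_addmx; last exact: measurableT_comp.
  by apply: measurableT_comp => //; exact: measurableT_comp.
have BE p : B p = B0 + (X p.1 - P0 *m X p.1 *m P0^T) + Z p.2.
  by rewrite /B /H /F /Y dennis_update_projection.
have BsE p : B p *m s = Y p.1.
  rewrite /B /H mulmxDl /F dennis_update_secant//.
  by rewrite /Z -!mulmxA tr_secant_projK// !mulmx0 addr0.
pose B' : {mfun (T * T)%type >-> 'M[R]_N} := HB.pack B (isMeasurableFun.Build _ _ _ _ B mB).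
exists _, (T * T)%type, (P \x P)%E, B', (noise_kernel P mH).
split; first split.
- move=> p; rewrite /= /B /H trmxD ZT dennis_update_sym//.
- move=> t A mA; pose A0 := vec_mx t^T.
  have tE : t = (mxvec A0)^T by rewrite vec_mxK trmxK.
  pose A1 := A0 - P0^T *m A0 *m P0; pose A2 := P0^T *m A0 *m P0.
  have v1 := symkron_form_ge0 A1 Wpos; have v2 := symkron_form_ge0 A2 Wpos.
  have L := has_normal_law_indepD (measurable_pairing A1 mX) (measurable_pairing A2 mX)
    v1 v2 (Xlaw A1) (Xlaw A2).
  have := has_normal_law_affine 1 (pairing B0 A0) (addr_ge0 v1 v2) L mA.
  have -> : 1 * (0 + 0) + pairing B0 A0 = pairing B0 A0 by rewrite addr0 mulr0 add0r.
  (* The variances of the two independent parts add up to the prior variance. *)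
  have -> : 1 ^+ 2 * (symkron_form W A1 + symkron_form W A2) = symkron_form W A0.
    by rewrite expr1n mul1r; exact: symkron_form_projection.
  move=> LB.
  rewrite tE mxvec_pairing symkron_formE; last by case: Wpos.
  have pD M1 M2 : pairing (M1 + M2) A0 = pairing M1 A0 + pairing M2 A0.
    by rewrite trmxD mulmxDl mxtraceD.
  have pN M1 : pairing (- M1) A0 = - pairing M1 A0.
    by rewrite trmxN mulNmx raddfN.
  have pA1 M1 : pairing M1 A1 = pairing M1 A0 - pairing M1 A2.
    by rewrite /A1 mulmxBr mxtraceD raddfN.
  have pairE p : pairing (B p) A0 =
      1 * (pairing (X p.1) A1 + pairing (X p.2) A2) + pairing B0 A0.
    rewrite BE !(pD, pN) -[P0 *m X p.1 *m P0^T]/(Z p.1) !Z_pairing -/A2 pA1.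
    by rewrite mul1r -addrA addrC.
  rewrite -LB; transitivity ((P \x P)%E ((fun p => pairing (B p) A0) @^-1` A)).
    congr ((P \x P)%E _); apply/funext => p /=; by rewrite mxvec_pairing.
  congr ((P \x P)%E _); apply/funext => p; by rewrite /= pairE.
- move=> U oU Uy.
  (* [V] contains the symmetric matrix [Bt - B0], because [y] is attained by the symmetric matrix
     [Bt]; hence it has positive mass. *)
  pose V := [set M : 'M[R]_N | U ((B0 + M) *m s)].
  have oV : open V.
    rewrite -[V]/((fun M => (B0 + M) *m s) @^-1` U); apply: open_comp => // M _.
    apply: continuous_mulmx; last exact: cst_continuous.
    by apply: continuous_addmx => [|?]; [exact: cst_continuous|exact: cvg_id].
  have mV : measurable (X @^-1` V).
    by have := mX measurableT _ (matrix_open_measurable oV); rewrite setTI.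
  rewrite (_ : _ @^-1` U = (X @^-1` V) `*` setT); last first.
    by apply/seteqP; split => p /=; rewrite BsE => // -[].
  suff : (0 < (P \x P)%E (X @^-1` V `*` [set: T]))%E by [].
  have -> := @product_measure1E _ _ _ _ _ P P _ _ mV measurableT.
  rewrite [X in (_ * X)%E]probability_setT mule1.
  apply: (Xsupp V (Bt - B0)) => //; first by rewrite /V/= addrC subrK.
  by rewrite trmxD trmxN BtT B0T.
- rewrite (_ : (fun w => B' w *m s) = (fun p => Y p.1)); last exact/funext/BsE.
  exact: cond_distribution_noise.
- apply: noise_kernel_weakly_continuous => w.
  by apply: continuous_addmx; [exact: cF|exact: cst_continuous].
- move=> i j; pose D := P0^T *m delta_mx i j *m P0.
  have v0 := symkron_form_ge0 D Wpos.
  have Zij w : Z w i j = pairing (X w) D by rewrite -pairing_delta Z_pairing.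
  have mZij : measurable_fun setT (fun w => pairing (X w) D) by exact: measurable_pairing.
  have intZ := has_normal_law_integrable mZij v0 (Xlaw D).
  have meanZ := has_normal_law_mean0 mZij v0 (Xlaw D).
  have me : measurable_fun setT (fun M : 'M[R]_N => M i j).
    exact: measurable_matrix_entry.
  have intF : P.-integrable setT (EFin \o (fun _ : T => F y i j)).
    by apply: (@bounded_integrable _ _ _ _ _ `|F y i j|).
  (* The noise entry is a centred normal variable, so only [F y] contributes to the mean. *)
  have HE : (fun w => H y w i j) = (fun w => F y i j + pairing (X w) D).
    by apply/funext => w; rewrite -Zij mxE.
  have intH : P.-integrable setT (EFin \o (fun w => H y w i j)).
    by rewrite HE; exact: (integrableD measurableT intF intZ).
  split.
    have mHy : measurable_fun setT (H y).
      by apply: measurable_addmx; [exact: mcst|exact: mZ].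
    have meE : measurable_fun setT (fun M : 'M[R]_N => (M i j)%:E) by exact/measurable_EFinP.
    exact: (integrable_pushforward mHy meE intH measurableT).
  rewrite -[RHS]/(\int[noise_kernel P mH y]_M M i j).
  rewrite (Rintegral_noise_kernel mH me intH) HE RintegralD//.
  rewrite [X in _ + X]/Rintegral meanZ addr0 Rintegral_cst// [X in fine X]probability_setT.
  by rewrite mulr1.
Qed.

End posterior_exists.

Theorem corollary2p4 (R : realType) (N : nat) (B0 : 'M[R]_N)
    (s y : 'cV[R]_N) (hB0 : B0^T = B0) (hs : s != 0)
    (hy : exists2 Bt : 'M[R]_N, Bt^T = Bt & y = Bt *m s) :
  exists B1 : 'M[R]_N -> 'M[R]_N,
    (forall W : 'M[R]_N, posdef W ->
       forall M : 'M[R]_N, is_posterior_mean B0 W s y M <-> M = B1 W) /\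
    [set B1 W | W in [set W : 'M[R]_N | posdef W]] =
    [set dennis_update B0 s y c | c in [set c : 'cV[R]_N | dot c s != 0]].
Proof.
have [Bt BtT yE] := hy.
exists (fun W => dennis_update B0 s y (W *m s)); split; last exact: dennis_posdef.
move=> W Wpos M.
have [d [T [P [B [k [[BT Bg supp] cd wc mean]]]]]] :=
  dennis_posterior_exists hB0 BtT Wpos hs.
rewrite -yE in supp mean.
split=> [|->]; last first.
  by exists d, T, P, B, (kernel_law k y); split => //; exists k.
move=> [d' [T' [P' [B' [nu [BT' Bg' [k' [cd' wc' nuE]] mean']]]]]].
(* The two priors may live on different spaces, but both prescribe the same normal law for every
   linear functional. *)
have same_law A (D : set R) : measurable D ->
    P' ((fun w => \tr ((B' w)^T *m A)) @^-1` D) =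
    P ((fun w => \tr ((B w)^T *m A)) @^-1` D).
  move=> mD; have E d1 (S : measurableType d1) (C : S -> 'M[R]_N) :
      (fun w => \tr ((C w)^T *m A)) @^-1` D =
      (fun w => (mxvec (C w) *m (mxvec A)^T) 0 0) @^-1` D.
    by apply/funext => w /=; rewrite mxvec_pairing.
  transitivity (normal_law ((mxvec B0 *m (mxvec A)^T) 0 0)
      (dot (mxvec A)^T (symkron W *m (mxvec A)^T)) D).
    rewrite E; exact: Bg'.
  rewrite E; symmetry; exact: Bg.
apply: (posterior_mean_unique _ _ same_law cd' cd wc' wc supp nuE _ mean' mean) => //.
Qed.
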